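(* Let $\mathfrak{r}=\mathfrak{n}\oplus\mathfrak{t}$ be a solvable rigid Lie algebra of rank one and trivial center, with nilradical $\mathfrak{n}$ and torus $\mathfrak{t}$. Then $\mathfrak{r}$ admits a fundamental set of invariants formed by quotients of invariant polynomials of the nilradical $\mathfrak{n}$.
   Context: All Lie algebras are finite dimensional over $\mathbb{C}$. A Lie algebra $\mathfrak{g}=(V,\mu)$ is rigid if the orbit of $\mu$ under the natural action of $GL(V)$ by change of basis is open in the algebraic set of all Lie algebra laws on $V$. A solvable rigid Lie algebra decomposes as a vector space direct sum $\mathfrak{r}=\mathfrak{n}\oplus\mathfrak{t}$, where $\mathfrak{n}$ is the nilradical and $\mathfrak{t}$ is an abelian subalgebra all of whose elements are $ad$-semisimple (a torus); the dimension of a maximal torus is the rank of the algebra, so rank one means $\dim\mathfrak{t}=1$. Invariants: if $X_1,\dots,X_n$ is a basis of a Lie algebra $\mathfrak{g}$ with $[X_i,X_j]=\sum_k C_{i,j}^k X_k$, and $x_1,\dots,x_n$ are the corresponding linear coordinates on $\mathfrak{g}^*$, put $\widetilde{X}_i=\sum_{j,k}(-C_{i,j}^k)\,x_k\,\frac{\partial}{\partial x_j}$. A function $F$ on $\mathfrak{g}^*$ (possibly defined only on a nonempty open subset, e.g. a rational function) is an invariant of $\mathfrak{g}$ if $\widetilde{X}_iF=0$ for all $i$. A fundamental set of invariants is a maximal set of functionally independent invariants; its cardinality is $\dim\mathfrak{g}$ minus the generic rank of the matrix $\left(\sum_k C_{i,j}^k x_k\right)_{i,j}$ (it is empty if there are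 only constant invariants). An invariant polynomial of $\mathfrak{n}$ is a polynomial function on $\mathfrak{n}^*$ that is an invariant of $\mathfrak{n}$; it is regarded as a function on $\mathfrak{r}^*$ through the coordinates corresponding to a basis of $\mathfrak{n}\subset\mathfrak{r}$. *)

(* Defs.v *)
From HB Require Import structures.
From mathcomp Require Import all_boot all_order all_algebra.
From mathcomp Require Import boolp classical_sets topology normedtype derive.
From mathcomp Require Import -(notations) mpoly.
Set Implicit Arguments.
Unset Strict Implicit.
Unset Printing Implicit Defensive.
Import Order.TTheory GRing.Theory Num.Theory.
Import numFieldNormedType.Exports.
Local Open Scope classical_set_scope.
Local Open Scope ring_scope.

(* Everything is written over an arbitrary [K : numClosedFieldType], which is
   what makes the norm and topology instances of 'rV[K]_n available; the
   intended instance is K := R[i] with R : realType.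

   The notations of [mpoly] clash with those of [derive] and are not imported:
   [mpoly n K] is {mpoly K[n]} and [meval v p] is p.@[v]. *)

Section LieLaws.
Context {K : numClosedFieldType} {V : vectType K}.

(* A bilinear map V x V -> V is an element of the vector space Hom(V, End V),
   so [mu x] is ad x and [mu x y] is [x, y]. *)
Local Notation bilin := 'Hom(V, 'End(V)).

Implicit Types (mu : bilin) (A B I : {vspace V}) (f : 'End(V)).

Definition lie_law : set bilin :=
  [set mu : bilin | (forall x, mu x x = 0) /\
            (forall x y z,
               mu x (mu y z) + mu y (mu z x) + mu z (mu x y) = 0)].

Definition GL_orbit mu : set bilin :=
  [set nu : bilin | exists2 f : 'End(V), lker f == 0%VS &
            forall x y, nu x y = f (mu (f^-1%VF x) (f^-1%VF y))].

Definition bracketv mu A B : {vspace V} :=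
  <<[seq mu x y | x <- vbasis A, y <- vbasis B]>>%VS.

Definition lower_central mu A (k : nat) : {vspace V} :=
  iter k (bracketv mu A) A.

Definition derived_series mu A (k : nat) : {vspace V} :=
  iter k (fun B => bracketv mu B B) A.

Definition nilpotent_in mu A : Prop :=
  exists k, lower_central mu A k = 0%VS.

Definition solvable_law mu : Prop :=
  exists k, derived_series mu fullv k = 0%VS.

Definition is_ideal mu I : Prop := (bracketv mu fullv I <= I)%VS.

Definition is_nilradical mu I : Prop :=
  [/\ is_ideal mu I, nilpotent_in mu I &
      forall J : {vspace V}, is_ideal mu J -> nilpotent_in mu J -> (J <= I)%VS].

Definition trivial_center mu : Prop :=
  forall x, (forall y, mu x y = 0) -> x = 0.

Definition semisimple_end f : Prop :=
  forall A, (f @: A <= A)%VS ->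
  exists B, [/\ (f @: B <= B)%VS, (A + B)%VS = fullv & (A :&: B)%VS = 0%VS].

Definition is_torus mu A : Prop :=
  (forall x y, x \in A -> y \in A -> mu x y = 0) /\
  (forall x, x \in A -> semisimple_end (mu x)).

End LieLaws.
Notation bilin V := 'Hom(V, 'End(V)).

Section Zariski.
Context {K : numClosedFieldType} {W : vectType K}.

Definition poly_fun (p : mpoly (\dim {:W}) K) (w : W) : K :=
  meval (fun i => coord (vbasis {:W}) i w) p.

(* A is open in X for the topology induced on X by the Zariski topology of W. *)
Definition zariski_open_in (X A : set W) : Prop :=
  exists S : set (mpoly (\dim {:W}) K),
    A = X `&` [set w | exists2 p, S p & poly_fun p w != 0].

End Zariski.

Definition rigid {K : numClosedFieldType} {V : vectType K} (mu : bilin V) :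
  Prop := zariski_open_in (@lie_law K V) (GL_orbit mu).

Section Invariants.
Context {K : numClosedFieldType}.

Definition partial n (F : 'rV[K]_n -> K) (j : 'I_n) (x : 'rV[K]_n) : K :=
  'D_(delta_mx 0 j) F x.

(* A function "defined on U" is a total function whose values outside U are
   irrelevant.  [differentiable] is Frechet differentiability over K, so for
   K = R[i] and U open this is holomorphy on U. *)
Definition holomorphic_on n (U : set 'rV[K]_n) (F : 'rV[K]_n -> K) : Prop :=
  forall x, U x -> differentiable F x.

(* Functional independence is linear independence of the differentials at
   generic points, i.e. on a dense subset of the domain. *)
Definition functionally_independent n k (U : set 'rV[K]_n)
    (F : 'I_k -> 'rV[K]_n -> K) : Prop :=
  U `<=` closure
    [set x | U x /\ row_free (\matrix_(i < k, j < n) partial (F i) j x)].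

Definition extend_family n k (F : 'I_k -> 'rV[K]_n -> K)
    (G : 'rV[K]_n -> K) : 'I_k.+1 -> 'rV[K]_n -> K :=
  fun i => if unlift ord_max i is Some j then F j else G.

Context {V : vectType K}.

(* In the following X is a basis of a subalgebra g of (V, mu) (possibly
   g = V), and x : 'rV_n is the point of g^* taking the value [x 0 k] on the
   k-th element of X. *)

Definition struct_const (mu : bilin V) n (X : n.-tuple V) (i j k : 'I_n) : K :=
  coord X k (mu X`_i X`_j).

Definition coadjoint_field (mu : bilin V) n (X : n.-tuple V) (i : 'I_n)
    (F : 'rV[K]_n -> K) (x : 'rV[K]_n) : K :=
  \sum_(j < n) \sum_(k < n)
    (- struct_const mu X i j k) * x 0 k * partial F j x.

Definition invariant_on (mu : bilin V) n (X : n.-tuple V)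
    (U : set 'rV[K]_n) (F : 'rV[K]_n -> K) : Prop :=
  [/\ open U, U !=set0, holomorphic_on U F &
      forall x, U x -> forall i, coadjoint_field mu X i F x = 0].

(* A maximal functionally independent family of invariants, with common domain
   U.  A competitor G may have a smaller domain W, and independence of the
   enlarged family is then tested on W. *)
Definition fundamental_set (mu : bilin V) n (X : n.-tuple V) k
    (U : set 'rV[K]_n) (F : 'I_k -> 'rV[K]_n -> K) : Prop :=
  [/\ open U /\ U !=set0,
      forall i, invariant_on mu X U (F i),
      functionally_independent U F &
      forall (W : set 'rV[K]_n) (G : 'rV[K]_n -> K),
        W `<=` U -> invariant_on mu X W G ->
        ~ functionally_independent W (extend_family F G)].

Definition pol_at n (p : mpoly n K) (x : 'rV[K]_n) : K :=
  meval (fun i => x 0 i) p.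

Definition invariant_poly (mu : bilin V) n (X : n.-tuple V)
    (p : mpoly n K) : Prop :=
  invariant_on mu X setT (pol_at p).

End Invariants.

(* Main.v *)
Require Import Defs.
From HB Require Import structures.
From mathcomp Require Import all_boot all_order all_algebra.
From mathcomp Require Import boolp classical_sets functions reals topology normedtype derive.
From mathcomp Require Import complex.
From mathcomp Require Import -(notations) mpoly.
From mathcomp Require Import ring.
Set Implicit Arguments.
Unset Strict Implicit.
Unset Printing Implicit Defensive.
Import Order.TTheory GRing.Theory Num.Theory.
Import numFieldNormedType.Exports.
Local Open Scope classical_set_scope.
Local Open Scope ring_scope.

(** Let T span the torus and let a_i be the eigenvalues of ad T on n.

    Rigidity makes the a_i commensurable.  If b solves the linear system
    b_i + b_j = b_k for all nonzero structure constants C_ij^k in an eigenbasis,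
    then diag(b) is a derivation D commuting with ad T, and letting T act by
    ad T + eD is a line of Lie laws through mu; by rigidity almost all of them
    are isomorphic to mu.  Comparing eigenvalues, a + eb is for almost all e a
    multiple of a rearrangement of a, and two values of e with the same
    rearrangement give that b is proportional to a.  So the system has a
    one-dimensional solution space; having integer coefficients, it is spanned by
    a rational vector.

    The invariants of n are obtained by adjoining one generator of n at a time:
    each step is either vacuous or has a slice, hence costs exactly one
    independent differential.  At a generic point y the differentials of the
    invariant polynomials of n therefore have the tangent space of the coadjoint
    orbit as annihilator, and an independent family p_0, ..., p_k of
    T-eigenvectors with commensurable weights achieves this.  A T-eigenvector z in
    the centre of n has nonzero weight because r has trivial centre; hence
    some p_0, say, has nonzero weight, and suitable quotients
    p_i^a p_0^b / p_0^l have weight zero.  They form a fundamental set: z forces the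
    differentials of invariants of r to have no component along T, and T moves
    p_0, which costs one more dimension. *)

(** * Polynomial functions *)

(** Constants and variables generate the polynomial ring, so a property stable under sums and
    products only has to be checked on them. *)
Lemma mpoly_ring_ind (n : nat) (R : nzRingType) (P : mpoly n R -> Prop) :
  (forall c, P (mpolyC n c)) -> (forall i, P (mpolyX R (mnm1 i))) ->
  (forall p q, P p -> P q -> P (p + q)) ->
  (forall p q, P p -> P q -> P (p * q)) ->
  forall p, P p.
Proof.
move=> PC PX PD PM p; elim/mpolyind: p => [|c a p _ _ Pp].
  by rewrite -(mpolyC0 n R).
apply: (PD) => //; rewrite -mul_mpolyC; apply: (PM) => //.
rewrite mpolyXE_id; apply: (big_ind P) => [||i _]; [exact: PC | exact: PM |].
by elim: (a i) => [|k IHk]; [exact: PC | rewrite exprS; apply: (PM)].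
Qed.

Lemma mderiv_var (n : nat) (R : nzRingType) (i j : 'I_n) :
  mderiv i (mpolyX R (mnm1 j)) = (i == j)%:R.
Proof.
rewrite mderivX mnm1E; have [->|_] := eqVneq j i; last by rewrite scale0r.
rewrite scale1r -mpolyX0; congr mpolyX.
by apply/mnmP => l; rewrite mnmBE subnn mnm0E.
Qed.

Section PolynomialFunctions.
Context {K : numClosedFieldType}.

(** A nonzero polynomial has finitely many roots, so an injective sequence of scalars contains as
    many non-roots as desired. *)
Lemma nonroot_seq (g : {poly K}) (f : nat -> K) (N : nat) :
  g != 0 -> injective f ->
  exists s : seq nat, [/\ uniq s, size s = N & forall i, i \in s -> g.[f i] != 0].
Proof.
move=> + f_inj; elim: N g => [|N IHN] g g0; first by exists [::].
have [k gk] : exists k, g.[f k] != 0.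
  apply: contrapT => nk.
  have gr k : root g (f k) by apply/negPn/negP => h; apply: nk; exists k.
  have := @max_poly_roots _ g [seq f i | i <- iota 0 (size g)] g0.
  rewrite size_map size_iota ltnn => H; apply/notF/H.
    by apply/allP => _ /mapP [i _ ->].
  by rewrite map_inj_uniq ?iota_uniq.
(* The extra factor vanishes at [f k] and so keeps [k] from being chosen again. *)
have g'0 : g * ('X - (f k)%:P) != 0 by rewrite mulf_neq0 ?polyXsubC_eq0.
have [s [us ss hs]] := IHN _ g'0.
exists (k :: s); split => [/=||i].
- rewrite us andbT; apply/negP => /hs.
  by rewrite hornerM hornerXsubC subrr mulr0 eqxx.
- by rewrite /= ss.
- rewrite inE => /orP [/eqP -> // | /hs].
  by rewrite hornerM mulf_eq0 negb_or => /andP [].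
Qed.

Lemma natr_shift_inj (e : K) : e != 0 -> injective (fun i : nat => e / i.+2%:R).
Proof.
move=> e0 i j /(mulfI e0) /invr_inj /eqP.
by rewrite eqr_nat => /eqP [].
Qed.

Lemma meval_line (n : nat) (p : mpoly n K) (v w : 'I_n -> K) :
  exists g : {poly K}, forall t, g.[t] = meval (fun i => v i + t * w i) p.
Proof.
elim/mpoly_ring_ind: p => [c|i|p q [g hg] [h hh]|p q [g hg] [h hh]].
- by exists c%:P => t; rewrite hornerC mevalC.
- exists ((v i)%:P + 'X * (w i)%:P) => t.
  by rewrite !hornerE mevalXU.
- by exists (g + h) => t; rewrite hornerD mevalD hg hh.
- by exists (g * h) => t; rewrite hornerM mevalM hg hh.
Qed.

Section Derivatives.
Context {m n : nat} (s : 'I_m -> 'I_n).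
Local Notation ev p := (fun x : 'rV[K]_n => meval (fun i => x 0 (s i)) p).

(** The map [s] tells which coordinate of the point each variable reads: [id] gives functions on the
    dual of n, [lshift] the same functions on the dual of r. *)
Lemma meval_differentiable (p : mpoly m K) x : differentiable (ev p) x.
Proof.
elim/mpoly_ring_ind: p => [c|i|p q Hp Hq|p q Hp Hq].
- have -> : ev (mpolyC m c) = cst c by apply/funext => y; rewrite mevalC.
  exact: differentiable_cst.
- have -> : ev (mpolyX K (mnm1 i)) = (fun y => y 0 (s i)).
    by apply/funext => y; rewrite mevalXU.
  exact: differentiable_coord.
- have -> : ev (p + q) = ev p + ev q by apply/funext => y; rewrite mevalD.
  exact: differentiableD.
- have -> : ev (p * q) = ev p * ev q by apply/funext => y; rewrite mevalM.
  exact: differentiableM.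
Qed.

Lemma meval_derive (p : mpoly m K) x v :
  'D_v (ev p) x = \sum_i ev (mderiv i p) x * v 0 (s i).
Proof.
have dv q : derivable (ev q) x v.
  exact/diff_derivable/meval_differentiable.
elim/mpoly_ring_ind: p => [c|i|p q Hp Hq|p q Hp Hq].
- have -> : ev (mpolyC m c) = cst c by apply/funext => y; rewrite mevalC.
  by rewrite derive_cst big1 // => j _; rewrite mderivC meval0 mul0r.
- have -> : ev (mpolyX K (mnm1 i)) = (fun y => y 0 (s i)).
    by apply/funext => y; rewrite mevalXU.
  rewrite deriveE; last exact: differentiable_coord.
  (* A coordinate is a continuous linear map, hence its own differential. *)
  have lin : linear (fun y : 'rV[K]_n => y 0 (s i) : K).
    by move=> a y z; rewrite !mxE.
  pose f := GRing.isLinear.Build K _ _ _ (fun y : 'rV[K]_n => y 0 (s i)) lin.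
  pose F : {linear 'rV[K]_n -> K} := HB.pack (fun y : 'rV[K]_n => y 0 (s i)) f.
  have -> : 'd (fun y : 'rV[K]_n => y 0 (s i)) x v = v 0 (s i).
    by rewrite (@diff_lin _ _ _ F) //; exact: coord_continuous.
  rewrite (bigD1 i) //= big1 => [|j ji]; rewrite mderiv_var.
    by rewrite eqxx meval1 mul1r addr0.
  by rewrite (negPf ji) meval0 mul0r.
- have -> : ev (p + q) = ev p + ev q by apply/funext => y; rewrite mevalD.
  rewrite deriveD // Hp Hq -big_split; apply: eq_bigr => i _ /=.
  by rewrite mderivD mevalD mulrDl.
- have -> : ev (p * q) = ev p * ev q by apply/funext => y; rewrite mevalM.
  rewrite deriveM // Hp Hq !scaler_sumr -big_split; apply: eq_bigr => i _ /=.
  rewrite mderivM mevalD !mevalM mulrDl /GRing.scale /= addrC.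
  by congr (_ + _); rewrite ?mulrA // -mulrA mulrC -!mulrA; congr (_ * _); rewrite mulrC.
Qed.

End Derivatives.

Lemma pol_at_differentiable (n : nat) (p : mpoly n K) x :
  differentiable (pol_at p) x.
Proof. exact: (@meval_differentiable n n id). Qed.

Lemma pol_at_partial (n : nat) (p : mpoly n K) j x :
  partial (pol_at p) j x = pol_at (mderiv j p) x.
Proof.
rewrite /partial (@meval_derive n n id) (bigD1 j) //= big1 ?addr0.
  by rewrite mxE !eqxx mulr1.
by move=> i /negPf ij; rewrite mxE ij andbF mulr0.
Qed.

(** Induction on the degree of the monomial: the constant coefficient is the value at 0, and any
    other coefficient is, up to a nonzero integer factor, a coefficient of a partial derivative,
    which also vanishes as a function. *)
Lemma pol_at_eq0 (n : nat) (p : mpoly n K) : (forall x, pol_at p x = 0) -> p = 0.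
Proof.
move=> p0; apply/mpolyP => a; rewrite mcoeff0.
elim: {a}(mdeg a) {-2}a (erefl (mdeg a)) p p0 => [|d IHd] a da p p0.
  have /eqP -> : a == (@mnm0 n) by rewrite -mdeg_eq0 da.
  have := p0 0; rewrite /pol_at mevalE.
  have [in0|/memN_msupp_eq0 -> //] := boolP ((@mnm0 n) \in msupp p).
  rewrite (bigD1_seq _ in0) //= [X in _ * X]big1 => [|i _]; last by rewrite mnm0E.
  rewrite mulr1 big1 ?addr0 // => b /eqP b0.
  have [i bi] : exists i, b i != 0%N.
    apply: contrapT => nb; apply: b0; apply/mnmP => i; rewrite mnm0E.
    by apply/eqP/negPn/negP => h; apply: nb; exists i.
  by rewrite (bigD1 i) //= mxE expr0n (negPf bi) mul0r mulr0.
have [i ai] : exists i, a i != 0%N.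
  apply: contrapT => na; move: da; rewrite mdegE big1 // => i _.
  by apply/eqP/negPn/negP => h; apply: na; exists i.
have ab : a = mnm_add (mnm_sub a (mnm1 i)) (mnm1 i) by rewrite submK // lep1mP.
have /IHd : mdeg (mnm_sub a (mnm1 i)) = d.
  by move: da; rewrite {1}ab mdegD mdeg1 addn1 => -[].
move=> /(_ (mderiv i p)); rewrite mcoeff_mderiv -ab => /(_ _) H.
have /eqP : mcoeff a p *+ ((mnm_sub a (mnm1 i)) i).+1 = 0.
  apply: H => x; rewrite -pol_at_partial.
  have -> : pol_at p = cst 0 by apply/funext.
  exact: derive_cst.
by rewrite mulrn_eq0 /= => /eqP.
Qed.

Lemma pol_at_neq0 (n : nat) (p : mpoly n K) : p != 0 -> exists x, pol_at p x != 0.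
Proof.
move=> /eqP p0; apply: contrapT => np; apply: p0; apply: pol_at_eq0 => x.
by apply/eqP/negPn/negP => h; apply: np; exists x.
Qed.

(** On the line from a point of [W] to a point where [p] is nonzero, [p] is a nonzero polynomial in
    one parameter, so it is nonzero at some small positive parameter. *)
Lemma pol_at_dense (n : nat) (p : mpoly n K) (W : set 'rV[K]_n) :
  p != 0 -> open W -> W !=set0 -> exists2 y, W y & pol_at p y != 0.
Proof.
move=> /pol_at_neq0 [y0 py0] Wo [x Wx].
have [g hg] := meval_line p (fun i => x 0 i) (fun i => (y0 - x) 0 i).
have gE t : g.[t] = pol_at p (x + t *: (y0 - x)).
  by rewrite hg; apply: meval_eq => i; rewrite !mxE.
have g0 : g != 0.
  apply: contraNneq py0 => g0.
  by have := gE 1; rewrite g0 horner0 scale1r addrC subrK => <-.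
have /nbhs_ballP [e /= e0 he] := open_nbhs_nbhs (conj Wo Wx).
(* Adding 1 to the norm covers the case [y0 = x]. *)
have v0 : 0 < `|y0 - x| + 1 by rewrite ltr_wpDl.
have e'0 : e / (`|y0 - x| + 1) != 0 by rewrite lt0r_neq0 ?divr_gt0.
have [s [_ ss hs]] := nonroot_seq 1 g0 (natr_shift_inj e'0).
case: s ss hs => //= i s _ /(_ i (mem_head _ _)).
set r := e / _ / _ => gr; have r0 : 0 < r by rewrite !divr_gt0 ?ltr0n.
exists (x + r *: (y0 - x)); last by rewrite -gE.
apply: he; rewrite -ball_normE /= opprD addrA subrr sub0r normrN normrZ gtr0_norm //.
rewrite /r mulrAC ltr_pdivrMr ?ltr0n // mulrAC ltr_pdivrMr // -mulrA ltr_pM2l //.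
apply: (@lt_le_trans _ _ (`|y0 - x| + 1)); first by rewrite ltrDl.
by rewrite ler_peMl ?ler1n // ltW.
Qed.

End PolynomialFunctions.

(** * Eigenvectors and nilpotent ideals *)

Section LinearAlgebra.

(** A free family inside [Q] is enlarged until it spans; the induction is on the codimension of its
    span. *)
Lemma free_spanning_seq (F : fieldType) (V : vectType F) (Q : V -> Prop) :
  exists s : seq V, [/\ forall v, v \in s -> Q v, free s &
                        forall v, Q v -> v \in <<s>>%VS].
Proof.
suff H k (s : seq V) : (\dim {:V} - size s <= k)%N -> free s ->
    (forall v, v \in s -> Q v) ->
    exists s : seq V, [/\ forall v, v \in s -> Q v, free s &
                          forall v, Q v -> v \in <<s>>%VS].
  by apply: (H _ [::]) => //; exact: nil_free.
elim: k s => [|k IHk] s sk fs Qs.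
all: have [[v Qv vs]|ns] := pselect (exists2 v, Q v & v \notin <<s>>%VS); first last.
1, 3: by exists s; split => // v Qv; apply/negPn/negP => vs; apply: ns; exists v.
all: have fvs : free (v :: s) by rewrite free_cons vs.
all: have sz : (size (v :: s) <= \dim {:V})%N.
1, 3: by rewrite -(eqP fvs); apply: dimvS; exact: subvf.
  by move: sk sz => /=; rewrite leqn0 subn_eq0 => h1 h2; have := leq_trans h2 h1; rewrite ltnn.
apply: (IHk (v :: s)) => //.
  by move: sk; rewrite /= leq_subLR addnS -addSn -leq_subLR.
by move=> w; rewrite inE => /orP [/eqP ->|/Qs].
Qed.

Context {K : numClosedFieldType} {V : vectType K}.

Lemma stable_eigenvector (f : 'End(V)) (A : {vspace V}) :
  (forall v, v \in A -> f v \in A) -> A != 0%VS ->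
  exists v a, [/\ v \in A, v != 0 & f v = a *: v].
Proof.
rewrite -dimv_eq0 -lt0n => fA A0.
pose X := vbasis A.
have XA i : X`_i \in A.
  have [lt|ge] := ltnP i (\dim A); last by rewrite nth_default ?size_tuple ?mem0v.
  by apply: vbasis_mem; rewrite mem_nth ?size_tuple.
pose M : 'M[K]_(\dim A) := \matrix_(i, j) coord X j (f X`_i).
have [a] : exists a, root (char_poly M) a.
  by apply/closed_rootP; rewrite size_char_poly; case: (\dim A) A0.
rewrite -eigenvalue_root_char => /eigenvalueP [v vM v0].
have fX : free X := basis_free (vbasisP A).
pose w := \sum_i v 0 i *: X`_i.
exists w, a; split.
- by apply: memv_suml => i _; rewrite memvZ.
- apply: contraNneq v0 => w0; apply/eqP/rowP => i.
  by rewrite mxE -(coord_sum_free (v 0) i fX) -/w w0 linear0.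
- rewrite linear_sum scaler_sumr.
  under eq_bigr => i _.
    rewrite linearZ /= (coord_basis (vbasisP A) (fA _ (XA i))) scaler_sumr.
    under eq_bigr => j _ do rewrite scalerA.
    over.
  rewrite exchange_big; apply: eq_bigr => j _ /=.
  rewrite -scaler_suml scalerA; congr (_ *: _).
  have := congr1 (fun r : 'rV_ _ => r 0 j) vM; rewrite !mxE => <-.
  by apply: eq_bigr => i _; rewrite mxE.
Qed.

(** The span of the eigenvectors in [A] has a stable complement [B]. If [B] met [A] outside 0, it
    would contain an eigenvector of [A], which also lies in the span. *)
Lemma semisimple_eigenbasis (f : 'End(V)) (A : {vspace V}) :
  semisimple_end f -> (forall v, v \in A -> f v \in A) ->
  exists s : seq V, basis_of A s /\ forall v, v \in s -> exists a, f v = a *: v.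
Proof.
move=> fss fA.
have [s [sQ fs sE]] := free_spanning_seq (fun v => v \in A /\ exists a, f v = a *: v).
exists s; split; last by move=> v /sQ [].
have sA : (<<s>> <= A)%VS by apply/span_subvP => v /sQ [].
rewrite /basis_of fs andbT eqEsubv sA /=.
have [B [fB sB sIB]] : exists B, [/\ (f @: B <= B)%VS, (<<s>> + B)%VS = fullv
    & (<<s>> :&: B)%VS = 0%VS].
  apply: fss; rewrite limg_span; apply/span_subvP => _ /mapP [v vs ->].
  by have [_ [a ->]] := sQ v vs; rewrite memvZ ?memv_span.
have [AB0|AB0] := eqVneq (A :&: B)%VS 0%VS.
  apply/subvP => v vA.
  have : v \in (<<s>> + B)%VS by rewrite sB memvf.
  case/memv_addP => x xs [y yB vE].
  suff : y \in (A :&: B)%VS by rewrite AB0 memv0 => /eqP y0; rewrite vE y0 addr0.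
  rewrite memv_cap yB andbT.
  by move: vA; rewrite vE rpredDl // (subvP sA).
have [v [a [vAB v0 fv]]] : exists v a, [/\ v \in (A :&: B)%VS, v != 0 & f v = a *: v].
  apply: stable_eigenvector AB0 => v; rewrite !memv_cap => /andP [vA vB].
  by rewrite fA //= (subvP fB) // memv_img.
move: vAB; rewrite memv_cap => /andP [vA vB].
have : v \in (<<s>> :&: B)%VS by rewrite memv_cap vB andbT; apply: sE; split=> //; exists a.
by rewrite sIB memv0 (negPf v0).
Qed.

End LinearAlgebra.

Section LieGeneralities.
Context {K : numClosedFieldType} {V : vectType K} (mu : bilin V).

Lemma brDl x y z : mu (x + y) z = mu x z + mu y z.
Proof. by rewrite linearD /= lfunE. Qed.

Lemma brZl c x z : mu (c *: x) z = c *: mu x z.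
Proof. by rewrite linearZ /= lfunE. Qed.

Lemma br0l z : mu 0 z = 0.
Proof. by rewrite linear0 lfunE. Qed.

Lemma brNl x z : mu (- x) z = - mu x z.
Proof. by rewrite -scaleN1r brZl scaleN1r. Qed.

Lemma br_suml (I : Type) (r : seq I) (F : I -> V) z :
  mu (\sum_(i <- r) F i) z = \sum_(i <- r) mu (F i) z.
Proof. by apply: (big_morph (fun x => mu x z)) => [x y|]; [exact: brDl|exact: br0l]. Qed.

Lemma mem_bracketv (A B : {vspace V}) u v :
  u \in A -> v \in B -> mu u v \in bracketv mu A B.
Proof.
move=> /coord_vbasis -> /coord_vbasis ->.
rewrite linear_sum; apply: memv_suml => j _; rewrite linearZ memvZ //=.
rewrite br_suml; apply: memv_suml => i _.
rewrite brZl memvZ // memv_span //.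
by apply/allpairsP; exists ((vbasis A)`_i, (vbasis B)`_j); rewrite !mem_nth ?size_tuple.
Qed.

Lemma bracketv_subP (A B C : {vspace V}) :
  reflect (forall u v, u \in A -> v \in B -> mu u v \in C) (bracketv mu A B <= C)%VS.
Proof.
apply: (iffP idP) => [/subvP ABC u v uA vB|H].
  by apply: ABC; exact: mem_bracketv.
by apply/span_subvP => _ /allpairsP [[u v] [/= uA vB ->]]; apply: H; exact: vbasis_mem.
Qed.

Hypothesis mu_lie : lie_law mu.

Lemma lie_anti x y : mu x y = - mu y x.
Proof.
have [alt _] := mu_lie.
have := alt (x + y); rewrite brDl !linearD /= !alt add0r addr0.
by move=> /eqP; rewrite addrC addr_eq0 => /eqP ->; rewrite opprK.
Qed.

Lemma lie_jacobi x y z : mu x (mu y z) = mu (mu x y) z + mu y (mu x z).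
Proof.
have [_ jac] := mu_lie; have := jac x y z.
rewrite (lie_anti z (mu x y)) (lie_anti z x) linearN => /eqP.
by rewrite subr_eq0 => /eqP <-; rewrite addrAC addrK.
Qed.

Context (n : {vspace V}) (n_nil : nilpotent_in mu n) (n_ideal : is_ideal mu n).
Let lc := lower_central mu n.

(** Modulo n every vector is a multiple of [T], and the bracket of [T] with itself is 0. *)
Lemma codim1_ideal_bracket (T : V) : (forall v, exists c, v - c *: T \in n) ->
  forall u v, mu u v \in n.
Proof.
move=> nT u v; have [[r un] [s vn]] := (nT u, nT v).
rewrite -[u](subrK (r *: T)) -[v](subrK (s *: T)).
move: (u - _) (v - _) un vn => p q pn qn.
have [alt _] := mu_lie; rewrite linearD linearZ /= !brDl !brZl alt scaler0 addr0.
by rewrite (lie_anti p T) !rpredD ?memvZ ?rpredN ?(bracketv_subP _ _ _ n_ideal) ?memvf.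
Qed.

Lemma ideal_mem u v : v \in n -> mu u v \in n.
Proof. by move=> vn; apply: (bracketv_subP _ _ _ n_ideal); rewrite ?memvf. Qed.

Lemma lower_central_bracket k u v : u \in n -> v \in lc k -> mu u v \in lc k.+1.
Proof. exact: mem_bracketv. Qed.

Lemma lower_central_ideal k u v : v \in lc k -> mu u v \in lc k.
Proof.
elim: k u v => [|k IHk] u v; first exact: ideal_mem.
(* The preimage of the next term under [mu u] has to contain that term; this is checked on brackets,
   where the Jacobi identity applies. *)
move=> vk; suff /subvP /(_ v vk) : (lc k.+1 <= mu u @^-1: lc k.+1)%VS.
  by rewrite -memv_preim.
apply/bracketv_subP => x y xn yk; rewrite -memv_preim lie_jacobi rpredD //.
  by rewrite lower_central_bracket // ideal_mem.
by rewrite lower_central_bracket // IHk.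
Qed.

Lemma lower_central_sub k : (lc k <= n)%VS.
Proof.
elim: k => [|k IHk]; first exact: subvv.
by apply/bracketv_subP => u v un vk; apply: ideal_mem; apply: (subvP IHk).
Qed.

(** Locates the last term of the lower central series at which [Q] fails. *)
Lemma nilpotent_last_step (Q : {vspace V} -> Prop) :
  Q 0%VS -> ~ Q n -> exists k, ~ Q (lc k) /\ Q (lc k.+1).
Proof.
move=> Q0 Qn; have [k lk] := n_nil.
have : Q (lc k) by rewrite /lc lk.
elim: {lk}k => [//|k IHk] Qk; have [/IHk //|nQ] := pselect (Q (lc k)).
by exists k.
Qed.

(** Take [e] outside [U] in the last term of the lower central series that is not contained in
    [U]. *)
Lemma nilpotent_step (U : {vspace V}) : ~~ (n <= U)%VS ->
  exists e, [/\ e \in n, e \notin U & forall u, u \in n -> mu u e \in U].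
Proof.
move=> nU.
have [||k [/negP lk lk1]] := @nilpotent_last_step (fun A => (A <= U)%VS).
- exact: sub0v.
- exact/negP.
have [e ek eU] : exists2 e, e \in lc k & e \notin U.
  apply: contrapT => ne; move/negP: lk; apply; apply/subvP => e ek.
  by apply/negPn/negP => eU; apply: ne; exists e.
exists e; split => // [|u un]; first exact: (subvP (lower_central_sub k)).
by apply: (subvP lk1); exact: lower_central_bracket.
Qed.

(** Builds n as an increasing chain of ideals of n, adjoining one vector at a time that n maps into
    the previous ideal. *)
Lemma nilpotent_ideal_ind (P : {vspace V} -> Prop) :
  P 0%VS ->
  (forall (U : {vspace V}) e, (U <= n)%VS -> P U -> e \in n ->
     (forall u v, u \in n -> v \in U -> mu u v \in U) ->
     (forall u, u \in n -> mu u e \in U) -> P (U + <[e]>)%VS) ->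
  P n.
Proof.
move=> P0 PS.
suff H k U : (\dim n - \dim U <= k)%N -> (U <= n)%VS -> P U ->
    (forall u v, u \in n -> v \in U -> mu u v \in U) -> P n.
  apply: (H _ 0%VS) => //; first exact: sub0v.
  by move=> u v _; rewrite !memv0 => /eqP ->; rewrite linear0.
elim: k U => [|k IHk] U Uk Un PU Uid.
  suff -> : n = U by [].
  apply/eqP; rewrite eq_sym -(dimv_leqif_eq Un) eqn_leq dimvS //.
  by rewrite -subn_eq0 -leqn0.
have [nU|/nilpotent_step [e [en eU ne]]] := boolP (n <= U)%VS.
  by suff -> : n = U by []; apply/eqP; rewrite eqEsubv nU Un.
apply: (IHk (U + <[e]>)%VS).
- suff : (\dim U < \dim (U + <[e]>))%N.
    by move: Uk; rewrite !leq_subLR => h1 h2; apply: (leq_trans h1); rewrite addnS -addSn leq_add2r.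
  rewrite (ltn_leqif (dimv_leqif_sup (addvSl U <[e]>%VS))).
  by apply: contra eU => /subvP; apply; rewrite memvE addvSr.
- by rewrite subv_add Un.
- exact: PS.
- move=> u v un /memv_addP [x xU [_ /vlineP [c ->] ->]].
  rewrite linearD linearZ /=; apply: (subvP (addvSl _ _)).
  by apply: rpredD; [exact: Uid | rewrite memvZ // ne].
Qed.

Lemma nilpotent_iter u v : u \in n -> v \in n -> exists k, iter k (mu u) v = 0.
Proof.
move=> un vn; have [k lk] := n_nil; exists k.
have : iter k (mu u) v \in lc k.
  by elim: (k) => [|i IHi] //=; exact: lower_central_bracket.
by rewrite /lc lk memv0 => /eqP.
Qed.

(** The last nonzero term of the lower central series is central in n and stable under [mu f], hence
    contains an eigenvector. *)
Lemma central_eigenvector (f : V) : n != 0%VS ->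
  exists z a, [/\ z \in n, z != 0, mu f z = a *: z & forall u, u \in n -> mu u z = 0].
Proof.
move=> /eqP n0.
have [//|k [/eqP lk lk1]] := @nilpotent_last_step (fun A => A = 0%VS) erefl.
have [|z [a [zk z0 fz]]] := @stable_eigenvector _ _ (mu f) (lc k) _ lk.
  by move=> v; exact: lower_central_ideal.
exists z, a; split => // [|u un]; first exact: (subvP (lower_central_sub k)).
by have := lower_central_bracket un zk; rewrite lk1 memv0 => /eqP.
Qed.

End LieGeneralities.

(** * Rationality of the weights of the torus *)

Lemma lfun_of_linear {F : fieldType} {U W : vectType F} (f : U -> W) :
  linear f -> exists g : 'Hom(U, W), forall x, g x = f x.
Proof.
move=> lin_f.
pose F0 := GRing.isLinear.Build F U W _ f lin_f.
pose f' : {linear U -> W} := HB.pack f F0.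
by exists (linfun f') => x; rewrite lfunE.
Qed.

Lemma bilin_of_bilinear {K : numClosedFieldType} {V : vectType K} (f : V -> V -> V) :
  (forall x, linear (f x)) -> (forall y, linear (f^~ y)) ->
  exists nu : bilin V, forall x y, nu x y = f x y.
Proof.
move=> linr linl.
have [g gE] := choice (fun x => lfun_of_linear (linr x)).
have [nu nuE] : exists nu : bilin V, forall x, nu x = g x.
  by apply: lfun_of_linear => c x y; apply/lfunP => z; rewrite !lfunE /= lfunE /= !gE linl.
by exists nu => x y; rewrite nuE.
Qed.

(** Turns identities between vectors into scalar ones, which [ring] can decide. *)
Lemma coord_inj {F : fieldType} {V : vectType F} (u v : V) :
  (forall i, coord (vbasis {:V}) i u = coord (vbasis {:V}) i v) -> u = v.
Proof.
move=> uv; rewrite (coord_vbasis (memvf u)) (coord_vbasis (memvf v)).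
by apply: eq_bigr => i _; rewrite uv.
Qed.

(** Some polynomial among those defining the open orbit is nonzero at [mu]; [g] is its restriction
    to the line. *)
Lemma rigid_line {K : numClosedFieldType} {V : vectType K} (mu nu : bilin V) :
  rigid mu -> lie_law mu -> (forall e, lie_law (mu + e *: nu)) ->
  exists g : {poly K}, g != 0 /\ forall e, g.[e] != 0 -> GL_orbit mu (mu + e *: nu).
Proof.
move=> [S orbE] mu_lie line_lie.
have {}orbE w : GL_orbit mu w = (lie_law w /\ exists2 p, S p & poly_fun p w != 0).
  by have := f_equal (fun A : set (bilin V) => A w) orbE.
have : GL_orbit mu mu.
  have inv1 (x : V) : (\1^-1)%VF x = x.
    have /lker0_lfunVK /(_ x) : lker (\1%VF : 'End(V)) == 0%VS.
      by apply/lker0P => y z; rewrite !id_lfunE.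
    by rewrite id_lfunE.
  exists \1%VF => [|x y]; last by rewrite id_lfunE !inv1.
  by apply/lker0P => y z; rewrite !id_lfunE.
rewrite orbE => -[_ [p Sp pmu]].
have [g gE] := meval_line p (fun i => coord (vbasis {:bilin V}) i mu)
                            (fun i => coord (vbasis {:bilin V}) i nu).
have gE' e : g.[e] = poly_fun p (mu + e *: nu).
  by rewrite gE; apply: meval_eq => i; rewrite linearD linearZ.
exists g; split => [|e ge].
  apply: contraNneq pmu => g0.
  by have := gE' 0; rewrite g0 horner0 scale0r addr0 => <-.
by rewrite orbE; split; [exact: line_lie | exists p; rewrite -?gE'].
Qed.

Section RationalWeights.
Context {K : numClosedFieldType} {V : vectType K} (mu : bilin V).
Hypothesis (mu_lie : lie_law mu) (mu_rigid : rigid mu).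
Context (n : {vspace V}).
Hypothesis (n_nil : nilpotent_in mu n) (n_ideal : is_ideal mu n).
Context (N : nat) (E : N.+1.-tuple V) (a : 'I_N.+1 -> K).
Let T := E`_0.
Hypothesis E_basis : basis_of fullv E.
Hypothesis E_n : forall i : 'I_N.+1, i != ord0 -> E`_i \in n.
Hypothesis n_E : forall v, v \in n -> coord E ord0 v = 0.
Hypothesis E_eigen : forall i : 'I_N.+1, mu T E`_i = a i *: E`_i.
Hypothesis a0 : a ord0 = 0.

(** The linear form with kernel n and value 1 at [T]. *)
Let tau (v : V) : K := coord E ord0 v.
Let C (i j k : 'I_N.+1) : K := coord E k (mu E`_i E`_j).
Let freeE : free E := basis_free E_basis.

Lemma basis_expand v : v = \sum_i coord E i v *: E`_i.
Proof. exact: coord_basis E_basis (memvf v). Qed.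

Lemma coord_basis_elt (i k : 'I_N.+1) : coord E k E`_i = (i == k)%:R.
Proof. by rewrite (coord_free _ _ freeE). Qed.

Lemma n_complement v : v - tau v *: T \in n.
Proof.
rewrite {1}(basis_expand v) big_ord_recl addrC addKr.
by apply: memv_suml => i _; rewrite memvZ // E_n.
Qed.

Lemma bracket_in_nilradical u v : mu u v \in n.
Proof.
apply: (codim1_ideal_bracket mu_lie n_ideal (T := T)) => w.
by exists (tau w); exact: n_complement.
Qed.

(* On each quotient of the lower central series of n, ad x acts as
   [tau x *: ad T], because its component in n lowers the series. *)
Lemma ad_eigenvalue x l v : v != 0 -> mu x v = l *: v -> exists i, l = tau x * a i.
Proof.
move=> v0 xv; apply: contrapT => nl.
have {}nl i : tau x * a i - l != 0.
  by apply/eqP => /eqP; rewrite subr_eq0 => /eqP h; apply: nl; exists i.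
have l0 : l != 0 by have := nl ord0; rewrite a0 mulr0 sub0r oppr_eq0.
pose y := x - tau x *: T.
have yn : y \in n := n_complement x.
have vn : v \in n.
  by rewrite -[v](scalerK l0) -xv; apply: memvZ; exact: bracket_in_nilradical.
(* If [l] is none of the predicted eigenvalues, [f] is diagonal with nonzero entries, hence
   bijective on every stable subspace. *)
pose f : 'End(V) := tau x *: mu T - l *: \1%VF.
have fE w : f w = tau x *: mu T w - l *: w.
  by rewrite /f add_lfunE opp_lfunE !scale_lfunE id_lfunE.
have f_coord w i : coord E i (f w) = (tau x * a i - l) * coord E i w.
  rewrite fE linearD linearZ /= -scaleNr linearZ /= mulNr mulrBl; congr (_ - _).
  rewrite {1}(basis_expand w) linear_sum linear_sum (bigD1 i) //= big1 => [|j ji].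
    by rewrite linearZ /= E_eigen !linearZ /= coord_basis_elt eqxx mulr1 addr0 mulrA mulrAC.
  by rewrite linearZ /= E_eigen !linearZ /= coord_basis_elt (negPf ji) !mulr0.
have f_inj : injective f.
  move=> w w' ff; rewrite (basis_expand w) (basis_expand w'); apply: eq_bigr => i _.
  by congr (_ *: _); apply: (mulfI (nl i)); rewrite -!f_coord ff.
(* Let [v] lie in term [k] but not in the next. Then [f v] lies in the next term, and bijectivity of
   [f] there puts [v] in it as well. *)
have [||k [/negP/negPn vk vk1]] := nilpotent_last_step n_nil (Q := fun A => v \notin A).
- by rewrite memv0.
- by rewrite vn.
have fv : f v \in lower_central mu n k.+1.
  have -> : f v = - mu y v.
    by rewrite fE -xv /y brDl brNl brZl opprD opprK addrC.
  by rewrite rpredN; apply: lower_central_bracket.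
have fL : (f @: lower_central mu n k.+1 <= lower_central mu n k.+1)%VS.
  apply/subvP => _ /memv_imgP [w wk ->].
  by rewrite fE rpredB ?memvZ // lower_central_ideal.
have /eqP fLE : (f @: lower_central mu n k.+1)%VS == lower_central mu n k.+1.
  rewrite -(dimv_leqif_eq fL) limg_dim_eq //.
  by have /lker0P/eqP -> := f_inj; rewrite capv0.
move: fv; rewrite -fLE => /memv_imgP [w wk /f_inj vw].
by move: vk1; rewrite vw wk.
Qed.

(** * Deformation of the law by a diagonal derivation *)

Section Deformation.
Context (b : 'I_N.+1 -> K).
Hypothesis b0 : b ord0 = 0.
Hypothesis bC : forall i j k, C i j k != 0 -> b i + b j = b k.

Let D (v : V) : V := \sum_i (b i * coord E i v) *: E`_i.

Lemma diag_linear : linear D.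
Proof.
move=> c u v; rewrite /D scaler_sumr -big_split; apply: eq_bigr => i _ /=.
by rewrite linearP /= mulrDr scalerDl scalerA mulrCA.
Qed.

Lemma diag_sum (I : Type) (r : seq I) (F : I -> V) :
  D (\sum_(i <- r) F i) = \sum_(i <- r) D (F i).
Proof.
apply: (big_morph D) => [x y|]; first by rewrite -{1}[x]scale1r diag_linear scale1r.
by rewrite /D big1 // => i _; rewrite linear0 mulr0 scale0r.
Qed.

Lemma diagZ c v : D (c *: v) = c *: D v.
Proof.
rewrite /D scaler_sumr; apply: eq_bigr => i _.
by rewrite linearZ /= scalerA mulrCA.
Qed.

Lemma diag_basis (i : 'I_N.+1) : D E`_i = b i *: E`_i.
Proof.
rewrite /D (bigD1 i) //= big1 => [|j ji]; rewrite coord_basis_elt.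
  by rewrite eqxx mulr1 addr0.
by rewrite eq_sym (negPf ji) mulr0 scale0r.
Qed.

Lemma diag_derivation u v : D (mu u v) = mu (D u) v + mu u (D v).
Proof.
have Dbasis (i j : 'I_N.+1) : D (mu E`_i E`_j) = mu (D E`_i) E`_j + mu E`_i (D E`_j).
  rewrite !diag_basis brZl linearZ /= -scalerDl {2}(basis_expand (mu _ _)) scaler_sumr.
  apply: eq_bigr => k _; rewrite scalerA.
  have [C0|Cn] := eqVneq (C i j k) 0; last by rewrite (bC Cn).
  by rewrite -/(C i j k) C0 !mulr0.
rewrite (basis_expand u) (basis_expand v).
rewrite br_suml !diag_sum !br_suml -big_split; apply: eq_bigr => i _ /=.
rewrite diagZ !brZl diagZ -scalerDr; congr (_ *: _).
move: (D E`_i) (Dbasis i) => w Ew.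
rewrite linear_sum [mu w _]linear_sum [X in _ + X]linear_sum diag_sum -big_split.
apply: eq_bigr => j _ /=.
by rewrite !diagZ !linearZ /= diagZ Ew -scalerDr.
Qed.

Lemma tau_bracket u v : tau (mu u v) = 0.
Proof. by apply: n_E; exact: bracket_in_nilradical. Qed.

Lemma tau_diag v : tau (D v) = 0.
Proof.
rewrite /tau /D linear_sum big1 // => i _; rewrite linearZ /= coord_basis_elt.
by have [->|_] := eqVneq i ord0; rewrite ?b0 ?mul0r ?mulr0.
Qed.

(* nu = tau /\ D, which lets T act by [mu T + e *: D] in [mu + e *: nu]. *)
Lemma deformation : exists nu : bilin V,
  (forall e, lie_law (mu + e *: nu)) /\ forall i : 'I_N.+1, nu T E`_i = b i *: E`_i.
Proof.
have tauP c u v : tau (c *: u + v) = c * tau u + tau v by rewrite /tau linearP.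
have [||nu nuE] := @bilin_of_bilinear _ _ (fun u v => tau u *: D v - tau v *: D u).
- move=> u c v w; rewrite diag_linear tauP.
  rewrite scalerBr !scalerDr scalerDl !scalerA [tau u * c]mulrC opprD.
  by rewrite addrACA.
- move=> v c u w; rewrite diag_linear tauP.
  by rewrite scalerBr !scalerDr scalerDl !scalerA [tau v * c]mulrC opprD addrACA.
have DB r x s y : D (r *: x - s *: y) = r *: D x - s *: D y.
  by rewrite -scaleNr diag_linear diagZ scaleNr.
have tau_nu u v : tau (nu u v) = 0.
  by rewrite nuE -scaleNr addrC tauP tau_diag mulr0 add0r
    -[_ *: _]addr0 tauP tau_diag mulr0
    add0r /tau linear0.
exists nu; split => [e|i]; last first.
  have D0 : D T = 0 by rewrite [T](_ : _ = E`_(ord0 : 'I_N.+1)) // diag_basis b0 scale0r.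
  rewrite nuE D0 scaler0 subr0 diag_basis.
  by rewrite /tau [T](_ : _ = E`_(ord0 : 'I_N.+1)) // coord_basis_elt eqxx scale1r.
have [alt jac] := mu_lie.
have mueE u v : (mu + e *: nu) u v = mu u v + e *: nu u v.
  by rewrite !add_lfunE !scale_lfunE.
split => [u|u v w].
  by rewrite mueE alt nuE subrr scaler0 addr0.
(* Expansion in powers of [e]. In the cyclic sum the constant terms vanish by Jacobi, the linear
   ones by antisymmetry, and the quadratic ones cancel in pairs. *)
have J1 x y z : (mu + e *: nu) x ((mu + e *: nu) y z) =
   mu x (mu y z) + e *: (tau y *: mu x (D z) - tau z *: mu x (D y)
     + tau x *: (mu (D y) z + mu y (D z))) + e *: (e *: (tau x *: (tau y *: D (D z) - tau z *: D (D y)))).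
  rewrite !mueE linearD linearZ /= [nu x (_ + _)]linearD /= [nu x (_ *: _)]linearZ /=.
  rewrite [nu x (mu _ _)]nuE tau_bracket scale0r subr0 diag_derivation.
  rewrite [nu x (nu _ _)]nuE tau_nu scale0r subr0 nuE.
  rewrite DB [mu x (_ - _)]raddfB /= !linearZ /=.
  move: (mu x (mu y z)) (mu x (D y)) (mu x (D z)) (mu (D y) z) (mu y (D z)) (D (D y)) (D (D z))
    (tau x) (tau y) (tau z).
  move=> v1 v2 v3 v4 v5 v6 v7 tx ty tz.
  apply: coord_inj => k; rewrite !(linearD, linearN, linearZ) /=.
  move: (coord _ k _) (coord _ k _) (coord _ k _) (coord _ k _) (coord _ k _) (coord _ k _) (coord _ k _).
  move=> c1 c2 c3 c4 c5 c6 c7; ring.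
rewrite !J1.
have L x y : mu x (D y) = - mu (D y) x by exact: lie_anti.
have := jac u v w; rewrite !L.
move: (mu u (mu v w)) (mu v (mu w u)) (mu w (mu u v)) (mu (D u) v) (mu (D u) w)
  (mu (D v) u) (mu (D v) w) (mu (D w) u) (mu (D w) v) (D (D u)) (D (D v)) (D (D w))
  (tau u) (tau v) (tau w).
move=> m1 m2 m3 v1 v2 v3 v4 v5 v6 v7 v8 v9 tu tv tw m123.
have -> : m1 = - m2 - m3 by apply/eqP; rewrite -opprD -addr_eq0 addrA m123.
apply: coord_inj => k; rewrite !(linearD, linearN, linearZ, linear0) /= /GRing.scale /=.
ring.
Qed.

End Deformation.
(** An isomorphism [f] from [mu] turns the eigenvectors of [T] for the deformed law into
    eigenvectors of the preimage of [T] for [mu], and [c] is the [tau] of that preimage. Taking [s]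
    as a finite function prepares a pigeonhole argument. *)
Lemma deformed_weights b : b ord0 = 0 ->
  (forall i j k, C i j k != 0 -> b i + b j = b k) ->
  exists g : {poly K}, g != 0 /\ forall e, g.[e] != 0 ->
    exists c (s : {ffun 'I_N.+1 -> 'I_N.+1}), forall i, a i + e * b i = c * a (s i).
Proof.
move=> b0 bC; have [nu [nu_lie nuT]] := deformation b0 bC.
have [g [g0 gP]] := rigid_line mu_rigid mu_lie nu_lie.
exists g; split=> // e /gP [f f0 fE].
have eig i : exists j, a i + e * b i = tau (f^-1%VF T) * a j.
  apply: (@ad_eigenvalue _ _ (f^-1%VF E`_i)).
    apply/eqP => Ei0; have := lker0_lfunVK f0 E`_i; rewrite Ei0 linear0 => /esym/eqP.
    by apply/negP; apply: (free_not0 freeE); rewrite mem_nth ?size_tuple.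
  have := fE T E`_i; rewrite add_lfunE add_lfunE scale_lfunE scale_lfunE.
  move=> /(congr1 (fun v => f^-1%VF v)); rewrite lker0_lfunK // => <-.
  by rewrite E_eigen nuT scalerA -scalerDl linearZ.
have [s sE] := choice eig.
by exists (tau (f^-1%VF T)), [ffun i => s i] => i; rewrite ffunE sE.
Qed.

Lemma weight_system_line b : b ord0 = 0 ->
  (forall i j k, C i j k != 0 -> b i + b j = b k) ->
  (exists i, a i != 0) -> exists c, forall i, b i = c * a i.
Proof.
move=> b0 bC [i0 ai0]; have [g [g0 gP]] := deformed_weights b0 bC.
have natr_inj : injective (fun i : nat => i%:R : K).
  by move=> i j /eqP; rewrite eqr_nat => /eqP.
(* One parameter more than there are maps [s], so that two parameters share the same map. *)
have [s [us ss sg]] := nonroot_seq #|{ffun 'I_N.+1 -> 'I_N.+1}|.+1 g0 natr_inj.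
have sg' (i : 'I_#|{ffun 'I_N.+1 -> 'I_N.+1}|.+1) : g.[(nth 0%N s i)%:R] != 0.
  by apply: sg; rewrite mem_nth // ss.
have [F FP] := choice (fun i => gP _ (sg' i)).
have [G GP] := choice FP.
have /injectivePn [i [j ij Gij]] : ~~ injectiveb G.
  by apply/negP => /injectiveP /leq_card; rewrite card_ord ltnn.
have {ij} : nth 0%N s i != nth 0%N s j by rewrite nth_uniq ?ss.
rewrite -(eqr_nat K); move: (GP i) (GP j); rewrite Gij.
move: (_%:R) (_%:R) (F i) (F j) (G j) => y x c d t.
move=> xP yP; rewrite eq_sym => xy.
have [c0|c0] := eqVneq c 0.
  have x0 : x != 0.
    apply: contraNneq ai0 => x0.
    by have /eqP := xP i0; rewrite c0 x0 !mul0r addr0.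
  exists (- x^-1) => k; have /eqP := xP k; rewrite c0 mul0r addr_eq0 => /eqP ->.
  by rewrite mulrNN mulKf.
(* Eliminating the shared right-hand side gives [(1 - r) * a = (r * x - y) * b]. The coefficient of
   [b] is nonzero, since otherwise [r = 1] and [x = y]. *)
pose r := d / c.
have rP k : a k + y * b k = r * (a k + x * b k) by rewrite yP xP /r mulrA divfK.
have rE k : (1 - r) * a k = (r * x - y) * b k.
  apply/eqP; rewrite -subr_eq0.
  have -> : (1 - r) * a k - (r * x - y) * b k = (a k + y * b k) - r * (a k + x * b k).
    by ring.
  by rewrite rP subrr.
have rx : r * x - y != 0.
  apply/eqP => rxy.
  have := rE i0; rewrite rxy mul0r => /eqP.
  rewrite mulf_eq0 (negPf ai0) orbF subr_eq0 => /eqP r1.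
  by move/eqP: rxy; rewrite -r1 mul1r subr_eq0 eq_sym; apply/negP.
exists ((1 - r) / (r * x - y)) => k; apply: (mulfI rx).
by rewrite -rE mulrA [X in _ = X * _]mulrC divfK.
Qed.

(** Since ad T is a derivation, [a] itself solves the system. *)
Lemma weight_system_weights i j k : C i j k != 0 -> a i + a j = a k.
Proof.
move=> Cijk; apply: (mulIf Cijk).
have : mu T (mu E`_i E`_j) = (a i + a j) *: mu E`_i E`_j.
  by rewrite lie_jacobi // !E_eigen brZl linearZ /= scalerDl.
move=> /(congr1 (coord E k)); rewrite linearZ /= => <-.
rewrite (basis_expand (mu E`_i E`_j)) linear_sum linear_sum (bigD1 k) //= big1 => [|l lk].
  by rewrite linearZ /= E_eigen !linearZ /= coord_basis_elt eqxx mulr1 addr0 mulrC.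
by rewrite linearZ /= E_eigen !linearZ /= coord_basis_elt (negPf lk) !mulr0.
Qed.

(* The weights solve a linear system with integer coefficients whose solution
   space over K is a line, hence is spanned by a rational vector. *)
Lemma rational_weights : exists (c : K) (r : 'I_N.+1 -> rat), forall i, a i = c * ratr (r i).
Proof.
have [an0|/forallNP a00] := pselect (exists i, a i != 0); last first.
  exists 0, (fun=> 0) => i; rewrite mul0r.
  by apply/eqP/negPn/negP => h; exact: (a00 i).
have [i0 ai0] := an0.
pose I := ('I_N.+1 * 'I_N.+1 * 'I_N.+1)%type.
(* One column per triple, which is zero when the structure constant is; solutions of the system are
   the row vectors killed by [A]. *)
pose A : 'M[rat]_(N.+1, #|{: I}|) := \matrix_(l, p)
  let: (i, j, k) := (enum_val p : I) in
  if C i j k != 0 then (l == i)%:R + (l == j)%:R - (l == k)%:R else 0.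
have mulA (b : 'rV[K]_N.+1) i j k : (b *m map_mx ratr A) 0 (enum_rank (i, j, k)) =
    if C i j k != 0 then b 0 i + b 0 j - b 0 k else 0.
  rewrite mxE; under eq_bigr => l _ do rewrite !mxE enum_rankK.
  case: ifP => _; last by rewrite big1 // => l _; rewrite rmorph0 mulr0.
  under eq_bigr => l _ do rewrite rmorphB rmorphD !rmorph_nat mulrBr mulrDr.
  rewrite !big_split /= sumrN.
  have pick (h : 'I_N.+1) : \sum_l b 0 l * (l == h)%:R = b 0 h.
    rewrite (bigD1 h) //= eqxx mulr1 big1 ?addr0 // => l /negPf ->.
    by rewrite mulr0.
  by rewrite !pick.
have solA (b : 'rV[K]_N.+1) : b *m map_mx ratr A = 0 <->
    forall i j k, C i j k != 0 -> b 0 i + b 0 j = b 0 k.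
  split=> [bA i j k Cijk|bC].
    have := mulA b i j k; rewrite bA mxE Cijk => /esym/eqP.
    by rewrite subr_eq0 => /eqP.
  apply/rowP => p; rewrite -(enum_valK p) [RHS]mxE.
  case: (enum_val p) => [[i j] k]; rewrite mulA.
  by case: ifP => // /bC ->; rewrite subrr.
(* The kernel over K contains [a]. As kernels commute with field extension, there is also a nonzero
   rational solution [v]. *)
have : kermx (map_mx ratr A : 'M[K]_(_, _)) != 0.
  apply/negP => /eqP ker0.
  have : (\row_i a i <= kermx (map_mx ratr A : 'M[K]_(_, _)))%MS.
    apply/sub_kermxP/solA => i j k /weight_system_weights; by rewrite !mxE.
  rewrite ker0 submx0 => /eqP /rowP /(_ i0); rewrite !mxE => /eqP.
  by rewrite (negPf ai0).
rewrite -map_kermx map_mx_eq0 => /rowV0Pn [v /sub_kermxP vA v0].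
have [||//|c cP] := @weight_system_line (fun i => ratr (v 0 i)).
- have : map_mx ratr v *m map_mx ratr A = 0 :> 'rV[K]_(_).
    by rewrite -map_mxM vA map_mx0.
  (* The structure constant of this triple is [a i0], which is nonzero; its equation forces [v] to
     vanish at [ord0]. *)
  move=> /solA /(_ ord0 i0 i0); rewrite !mxE => H.
  apply: (addIr (ratr (v 0 i0))); rewrite add0r; apply: H.
  rewrite /C; have := E_eigen i0; rewrite /T => ->.
  by rewrite linearZ /= coord_basis_elt eqxx mulr1.
- have : map_mx ratr v *m map_mx ratr A = 0 :> 'rV[K]_(_).
    by rewrite -map_mxM vA map_mx0.
  by move=> /solA H i j k /H; rewrite !mxE.
exists c^-1, (fun i => v 0 i) => i; rewrite cP mulKf //.
apply: contraNneq v0 => c0; apply/eqP/rowP => j; rewrite mxE.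
by have /eqP := cP j; rewrite c0 mul0r fmorph_eq0 => /eqP.
Qed.

End RationalWeights.

Lemma rational_torus_weights {K : numClosedFieldType} {V : vectType K} (mu : bilin V)
    (n : {vspace V}) (T : V) :
  lie_law mu -> rigid mu -> nilpotent_in mu n -> is_ideal mu n ->
  semisimple_end (mu T) -> (n + <[T]>)%VS = fullv -> T \notin n ->
  exists (c : K) (X : seq V), [/\ c != 0, basis_of n X &
    forall v, v \in X -> exists r : rat, mu T v = (c * ratr r) *: v].
Proof.
move=> mu_lie mu_rigid n_nil n_ideal Tss nT Tn.
have [X [X_basis X_eigen]] := semisimple_eigenbasis Tss (fun v => ideal_mem n_ideal T (v := v)).
have Xi_eigen (i : 'I_(size X)) : exists a, mu T X`_i = a *: X`_i.
  by apply: X_eigen; rewrite mem_nth.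
have [a' a'P] := choice Xi_eigen.
pose E : (size X).+1.-tuple V := [tuple of T :: in_tuple X].
pose a (i : 'I_(size X).+1) := if unlift ord0 i is Some j then a' j else 0.
have spanX : <<X>>%VS = n := span_basis X_basis.
have E_basis : basis_of fullv E.
  rewrite /basis_of /= span_cons spanX addvC nT eqxx free_cons spanX Tn.
  exact: basis_free X_basis.
have E_lift (j : 'I_(size X)) : E`_(lift ord0 j) = X`_j by [].
have E_n (i : 'I_(size X).+1) : i != ord0 -> E`_i \in n.
  by case: (unliftP ord0 i) => [j ->|->] // _; rewrite E_lift -spanX memv_span // mem_nth.
have n_E v : v \in n -> coord E ord0 v = 0.
  have Xb : basis_of n (in_tuple X) by [].
  move=> /(coord_basis Xb) ->; rewrite linear_sum big1 // => i _.
  rewrite linearZ /= -E_lift.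
  by rewrite (coord_free _ _ (basis_free E_basis)) mulr0.
have E_eigen (i : 'I_(size X).+1) : mu E`_0 E`_i = a i *: E`_i.
  rewrite /a; case: (unliftP ord0 i) => [j|] ->; first by rewrite E_lift; exact: a'P.
  by have [-> _] := mu_lie; rewrite scale0r.
have a0 : a ord0 = 0 by rewrite /a unlift_none.
have [c [r acr]] := rational_weights mu_lie mu_rigid n_nil n_ideal E_basis E_n n_E E_eigen a0.
have XE v : v \in X -> exists i : 'I_(size X).+1, mu T v = a i *: v.
  rewrite -index_mem => vX; exists (lift ord0 (Ordinal vX)).
  have Ev : E`_(lift ord0 (Ordinal vX)) = v by rewrite E_lift /= nth_index // -index_mem.
  by have := E_eigen (lift ord0 (Ordinal vX)); rewrite Ev => <-.
(* If [c = 0] all weights vanish and the unit 1 serves instead. *)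
have [c0|c0] := eqVneq c 0.
  exists 1, X; split; [exact: oner_neq0 | by [] |] => v /XE [i ->].
  by exists 0; rewrite acr c0 rmorph0 mul0r mulr0.
by exists c, X; split=> // v /XE [i ->]; exists (r i); rewrite acr.
Qed.

(** * The coadjoint action on polynomials *)

Section Coadjoint.
Context {K : numClosedFieldType} {V : vectType K} (mu : bilin V).
Hypothesis mu_lie : lie_law mu.
Context (n : {vspace V}) (m : nat) (Y : m.-tuple V).
Hypotheses (n_nil : nilpotent_in mu n) (n_ideal : is_ideal mu n).
Hypothesis Y_basis : basis_of n Y.

(* In the coordinates of n^* given by Y, an element w of n is the linear form
   [linear_form w], and [coad v] is the derivation extending ad v. *)
Definition linear_form (w : V) : mpoly m K :=
  \sum_(k < m) coord Y k w *: mpolyX K (mnm1 k).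

Definition coad (v : V) (p : mpoly m K) : mpoly m K :=
  \sum_(j < m) linear_form (mu v Y`_j) * mderiv j p.

Definition invariant_under (U : {vspace V}) (p : mpoly m K) :=
  forall u, u \in U -> coad u p = 0.

Lemma linear_form_linear : linear linear_form.
Proof.
move=> c u v; rewrite /linear_form scaler_sumr -big_split; apply: eq_bigr => i _ /=.
by rewrite linearP /= scalerDl scalerA.
Qed.

Lemma linear_formD u v : linear_form (u + v) = linear_form u + linear_form v.
Proof. by rewrite -{1}[u]scale1r linear_form_linear scale1r. Qed.

Lemma linear_form0 : linear_form 0 = 0.
Proof. by rewrite /linear_form big1 // => i _; rewrite linear0 scale0r. Qed.

Lemma linear_formZ c u : linear_form (c *: u) = c *: linear_form u.
Proof. by rewrite -[c *: u]addr0 linear_form_linear linear_form0 addr0. Qed.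

Lemma linear_form_sum (I : Type) (r : seq I) (F : I -> V) :
  linear_form (\sum_(i <- r) F i) = \sum_(i <- r) linear_form (F i).
Proof. exact: (big_morph _ linear_formD linear_form0). Qed.

Lemma basis_nth_mem (j : 'I_m) : Y`_j \in n.
Proof. by apply: (basis_mem Y_basis); rewrite mem_nth ?size_tuple. Qed.

Lemma linear_form_basis (j : 'I_m) : linear_form Y`_j = mpolyX K (mnm1 j).
Proof.
rewrite /linear_form (bigD1 j) //= big1 => [|i ij].
  by rewrite (coord_free _ _ (basis_free Y_basis)) eqxx scale1r addr0.
by rewrite (coord_free _ _ (basis_free Y_basis)) eq_sym (negPf ij) scale0r.
Qed.

Lemma coad_linear v : linear (coad v).
Proof.
move=> c p q; rewrite /coad scaler_sumr -big_split; apply: eq_bigr => i _ /=.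
by rewrite linearP /= mulrDr scalerAr.
Qed.

Lemma coadD v p q : coad v (p + q) = coad v p + coad v q.
Proof. by rewrite -{1}[p]scale1r coad_linear scale1r. Qed.

Lemma coad0 v : coad v 0 = 0.
Proof. by apply: (addrI (coad v 0)); rewrite -coadD !addr0. Qed.

Lemma coadZ v c p : coad v (c *: p) = c *: coad v p.
Proof. by rewrite -[c *: p]addr0 coad_linear coad0 addr0. Qed.

Lemma coad_sum v (I : Type) (r : seq I) (F : I -> mpoly m K) :
  coad v (\sum_(i <- r) F i) = \sum_(i <- r) coad v (F i).
Proof. exact: (big_morph _ (coadD v) (coad0 v)). Qed.

Lemma coadM v p q : coad v (p * q) = coad v p * q + p * coad v q.
Proof.
rewrite /coad mulr_suml mulr_sumr -big_split; apply: eq_bigr => i _ /=.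
by rewrite mderivM mulrDr; congr (_ + _); rewrite ?mulrA // [p * _]mulrC.
Qed.

Lemma coadC v c : coad v (mpolyC m c) = 0.
Proof. by rewrite /coad big1 // => i _; rewrite mderivC mulr0. Qed.

Lemma coadX v j : coad v (mpolyX K (mnm1 j)) = linear_form (mu v Y`_j).
Proof.
rewrite /coad (bigD1 j) //= big1 => [|i ij]; rewrite mderiv_var.
  by rewrite eqxx mulr1 addr0.
by rewrite (negPf ij) mulr0.
Qed.

Lemma coad_linear_form v w : w \in n -> coad v (linear_form w) = linear_form (mu v w).
Proof.
move=> wn; rewrite {2}(coord_basis Y_basis wn) linear_sum linear_form_sum.
rewrite {1}/linear_form coad_sum; apply: eq_bigr => j _.
by rewrite coadZ coadX linearZ /= linear_formZ.
Qed.

Lemma coad_linearl c u v p : coad (c *: u + v) p = c *: coad u p + coad v p.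
Proof.
rewrite /coad scaler_sumr -big_split; apply: eq_bigr => i _ /=.
by rewrite brDl brZl linear_form_linear mulrDl scalerAl.
Qed.

Lemma coad0l p : coad 0 p = 0.
Proof. by rewrite /coad big1 // => i _; rewrite br0l linear_form0 mul0r. Qed.

(** Both sides are derivations in [p], and they agree on the variables by the Jacobi identity. *)
Lemma coad_bracket u v p : coad (mu u v) p = coad u (coad v p) - coad v (coad u p).
Proof.
elim/mpoly_ring_ind: p => [c|j|p q Hp Hq|p q Hp Hq].
- by rewrite !coadC ?coad0 subr0.
- rewrite !coadX !coad_linear_form ?ideal_mem ?basis_nth_mem // lie_jacobi //.
  by rewrite linear_formD addrK.
- by rewrite !coadD Hp Hq opprD addrACA.
- rewrite !(coadM, coadD) Hp Hq.
  move: (coad u (coad v p)) (coad v (coad u p)) (coad u (coad v q)) (coad v (coad u q)).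
  move: (coad u p) (coad v p) (coad u q) (coad v q) => a b c d e f g h.
  by ring.
Qed.

Lemma coad_exp v p c k : coad v p = c *: p -> coad v (p ^+ k) = (c *+ k) *: p ^+ k.
Proof.
move=> cp; elim: k => [|k IHk]; first by rewrite expr0 -mpolyC1 coadC mulr0n scale0r.
by rewrite exprS coadM cp IHk -scalerAl -scalerAr -scalerDl -mulrS.
Qed.

Lemma coad_weightM v p q c d : coad v p = c *: p -> coad v q = d *: q ->
  coad v (p * q) = (c + d) *: (p * q).
Proof. by move=> cp dq; rewrite coadM cp dq -scalerAl -scalerAr -scalerDl. Qed.

Lemma iter_coad0 v k : iter k (coad v) 0 = 0.
Proof. by elim: k => //= k ->; rewrite coad0. Qed.

Lemma iter_coad_le v k l p : (k <= l)%N -> iter k (coad v) p = 0 -> iter l (coad v) p = 0.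
Proof. by move=> /subnK <- kp; rewrite iterD kp iter_coad0. Qed.

Lemma iter_coadD v k p q :
  iter k (coad v) (p + q) = iter k (coad v) p + iter k (coad v) q.
Proof. by elim: k => //= k ->; rewrite coadD. Qed.

(** In the Leibniz expansion every term has at least [a] derivations on [p] or [b] on [q]. *)
Lemma iter_coadM v k p q a b : (a + b <= k)%N ->
  iter a (coad v) p = 0 -> iter b (coad v) q = 0 -> iter k (coad v) (p * q) = 0.
Proof.
elim: k a b p q => [|k IHk] [|a] b p q abk ap bq //.
1, 2: by rewrite /= in ap; rewrite ap mul0r iter_coad0.
case: b abk bq => [|b] abk bq; first by rewrite /= in bq; rewrite bq mulr0 iter_coad0.
rewrite iterSr coadM iter_coadD (IHk a b.+1) -?iterSr ?add0r //.
by rewrite (IHk a.+1 b) -?iterSr // addSnnS.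
Qed.

Lemma coad_locally_nilpotent v p : v \in n -> exists k, iter k (coad v) p = 0.
Proof.
move=> vn; elim/mpoly_ring_ind: p => [c|j|p q [k Hk] [l Hl]|p q [k Hk] [l Hl]].
- by exists 1%N; rewrite /= coadC.
- have [k kj] := nilpotent_iter n_nil vn (basis_nth_mem j).
  exists k; rewrite -linear_form_basis.
  suff -> : iter k (coad v) (linear_form Y`_j) = linear_form (iter k (mu v) Y`_j).
    by rewrite kj linear_form0.
  elim: (k) => //= i ->; rewrite coad_linear_form //.
  by elim: (i) => [|l IHl] /=; [exact: basis_nth_mem | rewrite ideal_mem].
- exists (k + l)%N; rewrite iter_coadD (iter_coad_le (leq_addr l k) Hk).
  by rewrite (iter_coad_le (leq_addl k l) Hl) addr0.
- by exists (k + l)%N; apply: iter_coadM Hk Hl.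
Qed.

Lemma invariant_under_coad (U : {vspace V}) e p :
  (forall u, u \in U -> mu u e \in U) -> invariant_under U p ->
  invariant_under U (coad e p).
Proof.
move=> Ue Up u uU; have := coad_bracket u e p.
by rewrite (Up (mu u e)) ?Ue // (Up u) // coad0 subr0 => <-.
Qed.

Lemma invariant_underM (U : {vspace V}) p q :
  invariant_under U p -> invariant_under U q -> invariant_under U (p * q).
Proof. by move=> Up Uq u uU; rewrite coadM Up ?Uq // mul0r mulr0 addr0. Qed.

Lemma invariant_under1 (U : {vspace V}) : invariant_under U 1.
Proof. by move=> u _; rewrite -mpolyC1 coadC. Qed.

Lemma invariant_underX (U : {vspace V}) p k :
  invariant_under U p -> invariant_under U (p ^+ k).
Proof.
move=> Up; elim: k => [|k IHk]; first exact: invariant_under1.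
by rewrite exprS; apply: invariant_underM.
Qed.

Lemma invariant_under_lin (U : {vspace V}) c p q :
  invariant_under U p -> invariant_under U q -> invariant_under U (c *: p + q).
Proof. by move=> Up Uq u uU; rewrite coad_linear Up ?Uq // scaler0 addr0. Qed.

Lemma invariant_under_line (U : {vspace V}) e p :
  invariant_under (U + <[e]>)%VS p <-> invariant_under U p /\ coad e p = 0.
Proof.
split=> [Up|[Up ep] _ /memv_addP [u uU [_ /vlineP [c ->] ->]]].
  split=> [u uU|]; apply: Up; first exact: (subvP (addvSl _ _)).
  by rewrite memvE addvSr.
by rewrite addrC coad_linearl ep scaler0 add0r Up.
Qed.

(** Up to sign, the tangent vector at [x] to the coadjoint orbit given by [v]. *)
Definition coad_vector (v : V) (x : 'rV[K]_m) : 'rV[K]_m :=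
  \row_(j < m) pol_at (linear_form (mu v Y`_j)) x.

Definition dirderiv (w x : 'rV[K]_m) (p : mpoly m K) : K :=
  \sum_j w 0 j * pol_at (mderiv j p) x.

Lemma coad_eval v p x : pol_at (coad v p) x = dirderiv (coad_vector v x) x p.
Proof.
rewrite /pol_at /coad raddf_sum; apply: eq_bigr => j _ /=.
by rewrite mevalM mxE.
Qed.

Lemma dirderiv_linear w x : linear (dirderiv w x).
Proof.
move=> c p q; rewrite /dirderiv scaler_sumr -big_split; apply: eq_bigr => j _ /=.
by rewrite /pol_at linearP /= mevalD mevalZ mulrDr mulrCA.
Qed.

Lemma dirderivD w x p q : dirderiv w x (p + q) = dirderiv w x p + dirderiv w x q.
Proof. by rewrite -{1}[p]scale1r dirderiv_linear scale1r. Qed.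

Lemma dirderiv0 w x : dirderiv w x 0 = 0.
Proof. by apply: (addrI (dirderiv w x 0)); rewrite -dirderivD !addr0. Qed.

Lemma dirderivZ w x c p : dirderiv w x (c *: p) = c * dirderiv w x p.
Proof. by rewrite -[c *: p]addr0 dirderiv_linear dirderiv0 addr0. Qed.

Lemma dirderiv_linearl c w w' x p :
  dirderiv (c *: w + w') x p = c * dirderiv w x p + dirderiv w' x p.
Proof.
rewrite /dirderiv mulr_sumr -big_split; apply: eq_bigr => j _ /=.
by rewrite !mxE mulrDl mulrA.
Qed.

Lemma dirderivM w x p q :
  dirderiv w x (p * q) = dirderiv w x p * pol_at q x + pol_at p x * dirderiv w x q.
Proof.
rewrite /dirderiv mulr_suml mulr_sumr -big_split; apply: eq_bigr => j _ /=.
rewrite mderivM /pol_at mevalD !mevalM mulrDr.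
by congr (_ + _); rewrite ?mulrA // [_ * w 0 j]mulrC.
Qed.

Lemma dirderivX w x p k : dirderiv w x p = 0 -> dirderiv w x (p ^+ k) = 0.
Proof.
move=> wp; elim: k => [|k IHk]; last by rewrite exprS dirderivM wp IHk mul0r mulr0 addr0.
by rewrite expr0 -mpolyC1 /dirderiv big1 // => j _; rewrite mderivC /pol_at meval0 mulr0.
Qed.

Lemma dirderiv_var w x j : dirderiv w x (mpolyX K (mnm1 j)) = w 0 j.
Proof.
rewrite /dirderiv (bigD1 j) //= big1 => [|i ij]; rewrite mderiv_var /pol_at.
  by rewrite eqxx meval1 mulr1 addr0.
by rewrite (negPf ij) meval0 mulr0.
Qed.

Lemma coad_vector_linear c u v x :
  coad_vector (c *: u + v) x = c *: coad_vector u x + coad_vector v x.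
Proof.
apply/rowP => j; rewrite !mxE brDl brZl linear_form_linear.
by rewrite /pol_at mevalD mevalZ.
Qed.

(** By local nilpotency, some iterate of [coad e] on [p] is killed by two further applications but
    not by one. *)
Lemma exists_slice (U : {vspace V}) e p :
  e \in n -> (forall u, u \in U -> mu u e \in U) ->
  invariant_under U p -> coad e p != 0 ->
  exists q, [/\ invariant_under U q, coad e q != 0 & coad e (coad e q) = 0].
Proof.
move=> en Ue Up ep; have [k] := coad_locally_nilpotent p en.
elim: k p Up ep => [|k IHk] p Up ep /=; first by move=> p0; rewrite p0 coad0 eqxx in ep.
have [eep _|eep] := eqVneq (coad e (coad e p)) 0; first by exists p.
rewrite -iterS iterSr; apply: IHk => //.
exact: invariant_under_coad.
Qed.

(* If p is a slice for e, with q = e.p invariant, every U-invariant is a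
   polynomial in p over the localisation at q of the (U + <e>)-invariants; the
   induction on the nilpotency order kills the leading term in p. *)
Lemma dirderiv_slice (U : {vspace V}) e p w x :
  e \in n -> (forall u, u \in U -> mu u e \in U) ->
  invariant_under U p -> coad e (coad e p) = 0 -> pol_at (coad e p) x != 0 ->
  dirderiv w x p = 0 ->
  (forall g, invariant_under U g -> coad e g = 0 -> dirderiv w x g = 0) ->
  forall g, invariant_under U g -> dirderiv w x g = 0.
Proof.
move=> en Ue Up eep qx wp winv g Ug.
have [k] := coad_locally_nilpotent g en.
set q := coad e p in eep qx.
have Uq : invariant_under U q by exact: invariant_under_coad.
have wq : dirderiv w x q = 0 by exact: winv.
have iterM i (c f : mpoly m K) : coad e c = 0 ->
    iter i (coad e) (c * f) = c * iter i (coad e) f.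
  by move=> ec; elim: i => //= i ->; rewrite coadM ec mul0r add0r.
have iterp i : iter i (coad e) (p ^+ i) = i`!%:R *: q ^+ i.
  have eX j : coad e (p ^+ j.+1) = j.+1%:R *: (q * p ^+ j).
    elim: j => [|j IHj]; first by rewrite expr1 expr0 mulr1 scale1r.
    rewrite exprS coadM IHj -/q -scalerAr mulrCA -exprS.
    by rewrite -{1}[q * _]scale1r -scalerDl [in RHS]mulrS.
  elim: i => [|i IHi]; first by rewrite !expr0 scale1r.
  rewrite iterSr eX -mul_mpolyC iterM ?coadC // iterM // IHi mul_mpolyC.
  by rewrite -scalerAr -exprS scalerA -natrM factS.
elim: k g Ug => [|k IHk] g Ug; first by move=> /= ->; rewrite dirderiv0.
move=> /= ekg; set h := iter k (coad e) g in ekg.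
have Uh : invariant_under U h.
  rewrite /h; elim: (k) => //= i IHi; exact: invariant_under_coad.
have wh : dirderiv w x h = 0 by exact: winv.
have ep0 : coad e (q ^+ k) = 0 by rewrite (@coad_exp e q 0) ?mul0rn ?scale0r.
(* As [k] applications of [e] send [p ^+ k] to [k! q^k] and [g] to [h], they kill [g']. *)
pose g' := k`!%:R *: (q ^+ k * g) + - (h * p ^+ k).
have : dirderiv w x g' = 0.
  apply: IHk.
    rewrite /g'; apply: invariant_under_lin.
      by apply: invariant_underM => //; exact: invariant_underX.
    rewrite -scaleN1r -[_ *: _]addr0; apply: invariant_under_lin.
      by apply: invariant_underM => //; exact: invariant_underX.
    by move=> u _; rewrite coad0.
  rewrite /g' iter_coadD -mul_mpolyC iterM ?coadC // iterM // -/h.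
  rewrite -mulN1r iterM; last by rewrite -mpolyC1 -mpolyCN coadC.
  by rewrite iterM // iterp mulN1r mul_mpolyC -scalerAr mulrC subrr.
(* Along [w] only [k! q^k] times the derivative of [g] survives, and [q] is nonzero at [x]. *)
rewrite /g' dirderivD -scaleN1r !dirderivZ !dirderivM !(dirderivX _ wp) wh.
rewrite (dirderivX _ wq) !(mul0r, mulr0, add0r, addr0) => /eqP.
rewrite !mulf_eq0 pnatr_eq0 eqn0Ngt fact_gt0 /=.
by rewrite [pol_at _ _]rmorphXn expf_eq0 /= (negPf qx) andbF => /eqP.
Qed.

(* Rosenlicht's theorem for a nilpotent group: at a generic point the
   invariant polynomials separate the directions transverse to the orbit. *)
Lemma generic_orbit_tangent : exists2 h : mpoly m K, h != 0 &
  forall x, pol_at h x != 0 -> forall w,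
    (forall p, invariant_under n p -> dirderiv w x p = 0) ->
    exists2 u, u \in n & w = coad_vector u x.
Proof.
pose P U := exists2 h : mpoly m K, h != 0 & forall x, pol_at h x != 0 -> forall w,
    (forall p, invariant_under U p -> dirderiv w x p = 0) ->
    exists2 u, u \in U & w = coad_vector u x.
apply: (nilpotent_ideal_ind n_nil n_ideal (P := P)).
  exists 1; first exact: oner_neq0.
  move=> x _ w wp; exists 0; rewrite ?mem0v //; apply/rowP => j.
  rewrite mxE br0l linear_form0 /pol_at meval0 -(dirderiv_var w x) wp // => u.
  by rewrite memv0 => /eqP ->; rewrite coad0l.
move=> U e Un [h h0 hP] en Uid ne.
have Ue u : u \in U -> mu u e \in U by move=> uU; apply: ne; exact: (subvP Un).
have [[p0 Up0 ep0]|nop] := pselect (exists2 p, invariant_under U p & coad e p != 0).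
  have [p [Up ep eep]] := exists_slice en Ue Up0 ep0.
  exists (h * coad e p); first by rewrite mulf_neq0.
  move=> x; rewrite /pol_at mevalM mulf_eq0 negb_or => /andP [hx qx] w wp.
  rewrite -/(pol_at _ _) in qx; rewrite -/(pol_at _ _) in hx.
  (* With this multiple of the [e]-direction subtracted, [w] annihilates the slice [p], and hence
     all invariants of [U]. *)
  pose c := dirderiv w x p / pol_at (coad e p) x.
  have [|u uU wE] := hP x hx (- c *: coad_vector e x + w).
    apply: (dirderiv_slice en Ue Up eep qx) => [|g Ug eg].
      by rewrite dirderiv_linearl -coad_eval mulNr divfK // addNr.
    rewrite dirderiv_linearl -coad_eval eg /pol_at meval0 mulr0 add0r.
    by apply: wp; apply/invariant_under_line.
  exists (c *: e + u).
    rewrite addrC; apply: memv_add => //; exact: memvZ (memv_line e).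
  by rewrite coad_vector_linear -wE scaleNr addNKr.
(* No invariant of [U] is moved by [e], so adjoining [e] leaves the invariants unchanged. *)
exists h => // x hx w wp; have [p Up|u uU ->] := hP x hx w.
  apply: wp; apply/invariant_under_line; split=> //.
  by apply/eqP/negPn/negP => ep; apply: nop; exists p.
by exists u => //; exact: (subvP (addvSl _ _)).
Qed.

End Coadjoint.

(** * Weight decomposition of the invariants of the nilradical *)

Section WeightInvariants.
Context {K : numClosedFieldType} {V : vectType K} (mu : bilin V).
Hypothesis mu_lie : lie_law mu.
Context (n : {vspace V}) (m : nat) (Y : m.-tuple V).
Hypotheses (n_nil : nilpotent_in mu n) (n_ideal : is_ideal mu n).
Hypothesis Y_basis : basis_of n Y.
Context (T : V) (c : K) (X : seq V).
Hypotheses (c0 : c != 0) (X_basis : basis_of n X).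
Hypothesis X_weight : forall v, v \in X -> exists r : rat, mu T v = (c * ratr r) *: v.

Local Notation coad := (coad mu Y).
Local Notation linear_form := (linear_form Y).
Local Notation invariant := (invariant_under mu Y n).

Definition has_weight (r : rat) (p : mpoly m K) : Prop := coad T p = (c * ratr r) *: p.

Lemma has_weightZ r d p : has_weight r p -> has_weight r (d *: p).
Proof. by move=> rp; rewrite /has_weight coadZ rp !scalerA mulrC. Qed.

Lemma has_weightM r s p q : has_weight r p -> has_weight s q -> has_weight (r + s) (p * q).
Proof.
by move=> rp sq; rewrite /has_weight (coad_weightM rp sq) -mulrDr rmorphD.
Qed.

Lemma has_weightX r p k : has_weight r p -> has_weight (r *+ k) (p ^+ k).
Proof.
by move=> rp; rewrite /has_weight (coad_exp k rp) -mulrnAr -[in RHS]mulr_natr rmorphM /= rmorph_nat mulr_natr.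
Qed.

(** The linear forms of the eigenvectors [X] generate the polynomial ring, and weights add under
    products. A weight may occur several times in [qs]. *)
Lemma weight_decomposition p : exists qs : seq (rat * mpoly m K),
  (forall q, q \in qs -> has_weight q.1 q.2) /\ p = \sum_(q <- qs) q.2.
Proof.
elim/mpoly_ring_ind: p => [d|j|p q [s [sw ->]] [t [tw ->]]|p q [s [sw ->]] [t [tw ->]]].
- exists [:: (0, mpolyC m d)]; rewrite big_seq1; split=> // q.
  by rewrite inE => /eqP -> /=; rewrite /has_weight coadC rmorph0 mulr0 scale0r.
- have Xb : basis_of n (in_tuple X) by [].
  have Xw (i : 'I_(size X)) : exists r : rat, mu T X`_i = (c * ratr r) *: X`_i.
    by apply: X_weight; rewrite mem_nth.
  have [r rP] := choice Xw.
  exists [seq (r i, coord (in_tuple X) i Y`_j *: linear_form X`_i) | i <- enum 'I_(size X)].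
  split=> [_ /mapP [i _ ->] /=|].
    apply: has_weightZ; rewrite /has_weight (coad_linear_form _ Y_basis).
      by rewrite rP linear_formZ.
    by rewrite -(span_basis X_basis) memv_span // mem_nth.
  rewrite big_map big_enum /= -(linear_form_basis Y_basis).
  rewrite {1}(coord_basis Xb (basis_nth_mem Y_basis j)) linear_form_sum.
  by apply: eq_bigr => i _; rewrite linear_formZ.
- exists (s ++ t); rewrite big_cat; split=> // a.
  by rewrite mem_cat => /orP [/sw|/tw].
- exists [seq (a.1 + b.1, a.2 * b.2) | a <- s, b <- t]; split.
    by move=> _ /allpairsP [[a b] /= [/sw wa /tw wb ->]]; apply: has_weightM.
  rewrite big_allpairs_dep /= mulr_suml; apply: eq_bigr => a _.
  by rewrite mulr_sumr.
Qed.

Lemma invariant_coad_torus p : invariant p -> invariant (coad T p).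
Proof.
move=> ip u un; apply: (invariant_under_coad mu_lie n_ideal Y_basis _ ip) => // v vn.
by rewrite (lie_anti mu_lie) rpredN; apply: ideal_mem.
Qed.

(** Applying [coad T] minus the eigenvalue of [r0] removes the component of [r0] and multiplies the
    others by nonzero scalars, so induction applies to the rest. *)
Lemma invariant_weight_component (rs : seq rat) (comp : rat -> mpoly m K) :
  uniq rs -> (forall r, r \in rs -> has_weight r (comp r)) ->
  invariant (\sum_(r <- rs) comp r) -> forall r, r \in rs -> invariant (comp r).
Proof.
elim: rs comp => [//|r0 rs IHrs] comp /= /andP [r0rs urs] wcomp.
set p := \sum_(_ <- _) _ => ip.
have pE : p = comp r0 + \sum_(r <- rs) comp r by rewrite /p big_cons.
have irs r : r \in rs -> invariant (comp r).
  move=> rrs.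
  have dr0 : c * (ratr r - ratr r0) != 0.
    rewrite mulf_neq0 // subr_eq0 (inj_eq (fmorph_inj _)).
    by apply: contraNneq r0rs => <-.
  have : invariant ((c * (ratr r - ratr r0)) *: comp r).
    apply: (IHrs (fun r => (c * (ratr r - ratr r0)) *: comp r)) rrs => // [s srs|].
      by apply: has_weightZ; apply: wcomp; rewrite inE srs orbT.
    have -> : \sum_(s <- rs) (c * (ratr s - ratr r0)) *: comp s =
        (- (c * ratr r0)) *: p + coad T p.
      rewrite pE coadD wcomp ?mem_head // scalerDr addrACA scaleNr addNr add0r.
      rewrite coad_sum scaler_sumr -big_split !big_seq; apply: eq_bigr => s srs /=.
      by rewrite wcomp ?inE ?srs ?orbT // -scalerDl mulrBr addrC.
    by apply: invariant_under_lin => //; apply: invariant_coad_torus.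
  move=> ic u un; have := ic u un; rewrite coadZ => /eqP.
  by rewrite scaler_eq0 (negPf dr0) => /eqP.
move=> r; rewrite inE => /orP [/eqP ->|]; last exact: irs.
have -> : comp r0 = (-1) *: (\sum_(r <- rs) comp r) + p by rewrite pE scaleN1r addrC addrK.
apply: invariant_under_lin => // u un; rewrite coad_sum big_seq big1 // => s srs.
exact: irs.
Qed.

Lemma invariant_weight_decomposition p : invariant p ->
  exists qs : seq (mpoly m K),
    (forall q, q \in qs -> invariant q /\ exists r, has_weight r q) /\ p = \sum_(q <- qs) q.
Proof.
move=> ip; have [qs [qsw pE]] := weight_decomposition p.
pose rs := undup (map fst qs).
pose comp r := \sum_(q <- qs | q.1 == r) q.2.
have pE' : p = \sum_(r <- rs) comp r.
  rewrite pE /comp; under [RHS]eq_bigr do rewrite big_mkcond.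
  rewrite exchange_big /= !big_seq; apply: eq_bigr => q qqs.
  rewrite (bigD1_seq q.1) ?undup_uniq //=; last by rewrite mem_undup map_f.
  by rewrite eqxx big1 ?addr0 // => r /negPf; rewrite eq_sym => ->.
have wcomp r : has_weight r (comp r).
  rewrite /has_weight /comp big_mkcond coad_sum scaler_sumr !big_seq.
  apply: eq_bigr => q qqs; case: eqP => [<-|_]; first exact: qsw.
  by rewrite coad0 scaler0.
exists (map comp rs); rewrite big_map; split=> // _ /mapP [r rrs ->].
split; last by exists r.
by apply: (@invariant_weight_component rs) => //; rewrite ?undup_uniq -?pE'.
Qed.

Definition jacobian_at s (p : 'I_s -> mpoly m K) (x : 'rV[K]_m) : 'M[K]_(s, m) :=
  \matrix_(i, j) pol_at (mderiv j (p i)) x.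

Definition gradient (p : mpoly m K) (x : 'rV[K]_m) : 'rV[K]_m :=
  \row_j pol_at (mderiv j p) x.

Lemma dirderivE w x p : dirderiv w x p = (w *m (gradient p x)^T) 0 0.
Proof. by rewrite mxE; apply: eq_bigr => j _; rewrite !mxE. Qed.

Lemma dirderiv_jacobian_at s (p : 'I_s -> mpoly m K) w x i :
  dirderiv w x (p i) = (w *m (jacobian_at p x)^T) 0 i.
Proof. by rewrite mxE; apply: eq_bigr => j _; rewrite !mxE. Qed.

(** With [B] a right inverse of the Jacobian at [x0], the determinant of the Jacobian times [B] is a
    polynomial with value 1 at [x0]. *)
Lemma jacobian_row_free_generic s (p : 'I_s -> mpoly m K) x0 :
  row_free (jacobian_at p x0) ->
  exists2 h : mpoly m K, h != 0 & forall x, pol_at h x != 0 -> row_free (jacobian_at p x).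
Proof.
move=> /row_freeP [B JB].
pose h : mpoly m K := \det ((\matrix_(i, j) mderiv j (p i)) *m map_mx (@mpolyC m K) B).
have hE x : pol_at h x = \det (jacobian_at p x *m B).
  rewrite /pol_at /h -(det_map_mx (meval (fun i => x 0 i))) map_mxM; congr (\det (_ *m _)).
    by apply/matrixP => i j; rewrite !mxE.
  by apply/matrixP => i j; rewrite !mxE; exact: mevalC.
exists h.
  apply/eqP => h0; have := hE x0; rewrite h0 JB det1 /pol_at meval0 => /esym/eqP.
  by rewrite oner_eq0.
move=> x; rewrite hE => detJ; apply/row_freeP.
exists (B *m invmx (jacobian_at p x *m B)).
by rewrite mulmxA mulmxV // unitmxE unitfE.
Qed.

Let independent_weight_invariants s := exists (p : 'I_s -> mpoly m K) (x0 : 'rV[K]_m),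
  (forall i, invariant (p i) /\ exists r, has_weight r (p i)) /\ row_free (jacobian_at p x0).

(** Take as many weight invariants as possible with independent differentials at some point. At
    generic points their gradients then span those of all invariants of n. *)
Lemma weight_invariant_family : exists (s : nat) (p : 'I_s -> mpoly m K)
    (r : 'I_s -> rat) (h : mpoly m K),
  [/\ h != 0, forall i, invariant (p i), forall i, has_weight (r i) (p i) &
  forall x, pol_at h x != 0 ->
    [/\ row_free (jacobian_at p x),
        forall w, (forall i, dirderiv w x (p i) = 0) ->
          exists2 u, u \in n & w = coad_vector mu Y u x &
        forall q, invariant q -> (gradient q x <= jacobian_at p x)%MS]].
Proof.
pose P s := `[< independent_weight_invariants s >].
have P0 : exists s, P s.
  exists 0%N; apply/asboolP; exists (fun=> 0), 0; split=> [[]//|].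
  by rewrite /row_free -leqn0 rank_leq_row.
have Pm s : P s -> (s <= m)%N.
  by move=> /asboolP [p [x0 [_ /eqP <-]]]; exact: rank_leq_col.
have [s /asboolP [p [x0 [pP pfree]]] smax] := ex_maxnP P0 Pm.
have [h1 h10 h1P] := jacobian_row_free_generic pfree.
have [h2 h20 h2P] := generic_orbit_tangent mu_lie n_nil n_ideal Y_basis.
have [r rP] := choice (fun i => (pP i).2).
exists s, p, r, (h1 * h2); split=> //; first by rewrite mulf_neq0.
  by move=> i; have [] := pP i.
move=> x; rewrite /pol_at mevalM mulf_eq0 negb_or => /andP [/h1P Jx /h2P tanx].
have gradP q : invariant q -> (exists r, has_weight r q) ->
    (gradient q x <= jacobian_at p x)%MS.
  move=> iq wq; apply/negPn/negP => nJ.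
  (* A gradient outside the span would give an independent family with [s + 1] members. *)
  pose p' (i : 'I_(s + 1)) := match fintype.split i with inl i => p i | inr _ => q end.
  suff /smax : P (s + 1)%N by rewrite addn1 ltnn.
  apply/asboolP; exists p', x; split.
    by move=> i; rewrite /p'; case: fintype.split.
  have -> : jacobian_at p' x = col_mx (jacobian_at p x) (gradient q x).
    by apply/matrixP => i j; rewrite !mxE /p'; case: fintype.split => k; rewrite !mxE.
  rewrite /row_free -addsmxE eqn_leq; apply/andP; split.
    by rewrite addsmxE rank_leq_row.
  rewrite addn1 -{1}(eqP Jx).
  have : (jacobian_at p x < jacobian_at p x + gradient q x)%MS.
    by rewrite /ltmx addsmxSl addsmx_sub submx_refl.
  by rewrite ltmxErank => /andP [].
have gradI q : invariant q -> (gradient q x <= jacobian_at p x)%MS.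
  move=> /invariant_weight_decomposition [qs [qsP ->]].
  have -> : gradient (\sum_(a <- qs) a) x = \sum_(a <- qs) gradient a x.
    elim/big_rec2: _ => [|a g1 g2 _ <-]; apply/rowP => j; rewrite !mxE.
      by rewrite linear0 /pol_at meval0.
    by rewrite linearD /pol_at mevalD.
  rewrite big_seq; apply: summx_sub => a /qsP [ia wa]; exact: gradP.
split=> // w wp; apply: tanx => q /gradI /submxP [D qE].
rewrite dirderivE qE trmx_mul mulmxA.
suff -> : w *m (jacobian_at p x)^T = 0 by rewrite mul0mx mxE.
by apply/rowP => i; rewrite [RHS]mxE -(wp i) dirderiv_jacobian_at.
Qed.

End WeightInvariants.

(** * Quotients of invariants *)

(** Here [k] is the denominator of [r / s]; its numerator goes into [l] or [e] according to sign, as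
    exponents must be natural numbers. *)
Lemma rat_exponents (r s : rat) : s != 0 ->
  exists k e l : nat, (0 < k)%N /\ r *+ k + s *+ e = s *+ l.
Proof.
move=> s0; pose q := r / s; exists `|denq q|%N.
have dq : r *+ `|denq q|%N = (numq q)%:~R * s.
  rewrite numqE -absz_denq -mulrA [_ * s]mulrC mulrA [q * s]divfK //.
  by rewrite mulr_natr.
rewrite dq; case: (numq q) => l.
  exists 0%N, l; split; first by rewrite absz_gt0 denq_neq0.
  by rewrite mulr0n addr0 mulr_natl.
exists l.+1, 0%N; split; first by rewrite absz_gt0 denq_neq0.
by rewrite NegzE mulrNz mulNr -mulr_natl addNr mulr0n.
Qed.

Section TransverseRank.
Context {F : fieldType}.

(** The kernel of [A] contains that of [G] and also [t], which is outside the kernel of [G]; so [A]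
    has smaller rank than [G]. *)
Lemma transverse_rank k m (G A : 'M[F]_(k.+1, m)) (t : 'rV[F]_m) :
  row_free G -> (forall w : 'rV[F]_m, w *m G^T = 0 -> w *m A^T = 0) ->
  t *m G^T != 0 -> t *m A^T = 0 -> ~~ row_free A.
Proof.
move=> Gfree GA tG tA; apply/negP => Afree.
have KA : (kermx G^T + t)%MS *m A^T = 0.
  apply/row_matrixP => i.
  rewrite row_mul row0.
  have /sub_addsmxP [[u v] /= ->] : (row i (kermx G^T + t)%MS <= kermx G^T + t)%MS by exact: row_sub.
  rewrite mulmxDl -[v *m t *m _]mulmxA tA mulmx0 addr0; apply: GA.
  by rewrite -[_ *m G^T]mulmxA mulmx_ker mulmx0.
have := mulmx0_rank_max KA; rewrite mxrank_tr (eqP Afree).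
have : (kermx G^T < kermx G^T + t)%MS.
  by rewrite /ltmx addsmxSl addsmx_sub submx_refl /= sub_kermx.
rewrite ltmxErank mxrank_ker mxrank_tr (eqP Gfree) => /andP [_].
have km : (k.+1 <= m)%N by rewrite -(eqP Gfree) rank_leq_col.
move=> h1 h2; have := leq_ltn_trans h2 (leqnn _).
by move: h1; rewrite -(ltn_add2r k.+1) subnK // => /leq_ltn_trans /(_ (h2 : (_ < _.+1)%N)); rewrite ltnn.
Qed.

Lemma quotient_jacobian_free k m (G : 'M[F]_(k.+1, m)) (i0 : 'I_k.+1) (J : 'M[F]_(k, m))
    (al be : 'I_k -> F) :
  row_free G -> (forall i, al i != 0) ->
  (forall i, row i J = al i *: row (lift i0 i) G + be i *: row i0 G) -> row_free J.
Proof.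
move=> Gfree al0 JE.
pose C : 'M[F]_(k, k.+1) :=
  \matrix_(i, j) (al i * (j == lift i0 i)%:R + be i * (j == i0)%:R).
have -> : J = C *m G.
  apply/row_matrixP => i; rewrite JE row_mul mulmx_sum_row.
  rewrite (bigD1 i0) //= (bigD1 (lift i0 i)) ?(eq_sym _ i0) ?neq_lift //= big1 => [|j /andP [ji0 jl]].
    rewrite !mxE !eqxx (negPf (neq_lift i0 i)) eq_sym (negPf (neq_lift i0 i)).
    by rewrite !mulr0 !mulr1 addr0 add0r addr0 addrC.
  by rewrite !mxE (negPf ji0) (negPf jl) !mulr0 addr0 scale0r.
apply: inj_row_free => v; rewrite mulmxA => /eqP.
rewrite mulmx_free_eq0 // => /eqP vC; apply/rowP => i; rewrite [RHS]mxE.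
have := congr1 (fun w : 'rV_k.+1 => w 0 (lift i0 i)) vC; rewrite !mxE.
rewrite (bigD1 i) //= big1 => [|j ji].
  rewrite mxE eqxx eq_sym (negPf (neq_lift i0 i)) mulr1 mulr0 !addr0 => /eqP.
  by rewrite mulf_eq0 (negPf (al0 i)) orbF => /eqP.
rewrite mxE (inj_eq lift_inj) eq_sym (negPf ji) eq_sym (negPf (neq_lift i0 i)).
by rewrite !mulr0 addr0 mulr0.
Qed.

End TransverseRank.
Lemma derive_div {K : numClosedFieldType} {W : normedModType K} (f g : W -> K) x v :
  g x != 0 -> derivable f x v -> derivable g x v ->
  'D_v (fun y => f y / g y) x = ('D_v f x * g x - f x * 'D_v g x) / g x ^+ 2.
Proof.
move=> gx df dg; have dgV := derivableV gx dg.
have -> : (fun y => f y / g y) = f * (fun y => (g y)^-1) by [].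
rewrite (deriveM df dgV) (deriveV gx dg) /GRing.scale /=.
by move: ('D_v f x) ('D_v g x) (f x) => a b c; field.
Qed.

Section Quotients.
Context {K : numClosedFieldType} {m d : nat}.

(** [lsubmx] is the restriction of linear forms from r to n. *)
Definition quotient_fun (P Q : mpoly m K) (x : 'rV[K]_(m + d)) : K :=
  pol_at P (lsubmx x) / pol_at Q (lsubmx x).

Lemma pol_at_lsubmxE (p : mpoly m K) :
  (fun x : 'rV[K]_(m + d) => pol_at p (lsubmx x)) =
  (fun x => meval (fun i => x 0 (lshift d i)) p).
Proof. by apply/funext => x; apply: meval_eq => i; rewrite mxE. Qed.

Lemma pol_at_lsubmx_differentiable (p : mpoly m K) x :
  differentiable (fun x : 'rV[K]_(m + d) => pol_at p (lsubmx x)) x.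
Proof. by rewrite pol_at_lsubmxE; exact: meval_differentiable. Qed.

Lemma pol_at_lsubmx_derive (p : mpoly m K) (x v : 'rV[K]_(m + d)) :
  'D_v (fun x => pol_at p (lsubmx x)) x = dirderiv (lsubmx v) (lsubmx x) p.
Proof.
rewrite pol_at_lsubmxE meval_derive; apply: eq_bigr => i _.
rewrite [lsubmx v _ _]mxE mulrC; congr (_ * _).
by apply: meval_eq => j; rewrite mxE.
Qed.

Lemma pol_at_lsubmx_poly (p : mpoly m K) : p != 0 ->
  exists2 p' : mpoly (m + d) K, p' != 0 & forall x, pol_at p' x = pol_at p (lsubmx x).
Proof.
move=> p0; suff [p' p'E] : exists p' : mpoly (m + d) K, forall x, pol_at p' x = pol_at p (lsubmx x).
  exists p' => //; have [y py] := pol_at_neq0 p0.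
  apply: contraNneq py => p'0; have := p'E (row_mx y 0).
  by rewrite p'0 row_mxKl /pol_at meval0 => <-.
elim/mpoly_ring_ind: {p0}p => [c|i|p q [p' pE] [q' qE]|p q [p' pE] [q' qE]].
- by exists (mpolyC _ c) => x; rewrite /pol_at !mevalC.
- by exists (mpolyX K (mnm1 (lshift d i))) => x; rewrite /pol_at !mevalXU mxE.
- by exists (p' + q') => x; move: (pE x) (qE x); rewrite /pol_at !mevalD => -> ->.
- by exists (p' * q') => x; move: (pE x) (qE x); rewrite /pol_at !mevalM => -> ->.
Qed.

Lemma pol_at_lsubmx_dense (p : mpoly m K) (W : set 'rV[K]_(m + d)) :
  p != 0 -> open W -> W !=set0 -> exists2 x, W x & pol_at p (lsubmx x) != 0.
Proof.
move=> /pol_at_lsubmx_poly [p' p'0 p'E] Wo W0.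
by have [x Wx] := pol_at_dense p'0 Wo W0; rewrite p'E; exists x.
Qed.

Lemma pol_at_lsubmx_open (p : mpoly m K) :
  open [set x : 'rV[K]_(m + d) | pol_at p (lsubmx x) != 0].
Proof.
have -> : [set x : 'rV[K]_(m + d) | pol_at p (lsubmx x) != 0] =
    (fun x => pol_at p (lsubmx x)) @^-1` [set y | y != 0] by [].
apply: open_comp; last first.
  have -> : [set y : K | y != 0] = ~` [set 0].
    by apply/seteqP; split=> y /eqP.
  apply: closed_openC; apply: accessible_closed_set1.
  exact/hausdorff_accessible/norm_hausdorff.
move=> x _; exact/differentiable_continuous/pol_at_lsubmx_differentiable.
Qed.

Lemma quotient_fun_differentiable P Q x :
  pol_at Q (lsubmx x) != 0 -> differentiable (quotient_fun P Q) x.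
Proof.
move=> Qx; apply: differentiableM; first exact: pol_at_lsubmx_differentiable.
by apply: differentiableV => //; exact: pol_at_lsubmx_differentiable.
Qed.

Lemma quotient_fun_derive P Q (x v : 'rV[K]_(m + d)) : pol_at Q (lsubmx x) != 0 ->
  'D_v (quotient_fun P Q) x =
  (dirderiv (lsubmx v) (lsubmx x) P * pol_at Q (lsubmx x) -
   pol_at P (lsubmx x) * dirderiv (lsubmx v) (lsubmx x) Q) / pol_at Q (lsubmx x) ^+ 2.
Proof.
move=> Qx.
rewrite [LHS](@derive_div _ _ (fun x => pol_at P (lsubmx x)) (fun x => pol_at Q (lsubmx x))) //.
- by rewrite !pol_at_lsubmx_derive.
- exact/diff_derivable/pol_at_lsubmx_differentiable.
- exact/diff_derivable/pol_at_lsubmx_differentiable.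
Qed.

End Quotients.

(** * Coadjoint fields in coordinates adapted to n and T *)

Section Coordinates.
Context {K : numClosedFieldType} {V : vectType K} (mu : bilin V).
Hypothesis mu_lie : lie_law mu.
Context (n : {vspace V}) (m : nat) (Y : m.-tuple V) (Z : 1.-tuple V).
Hypothesis Y_basis : basis_of n Y.
Hypothesis bracket_n : forall u v, mu u v \in n.
Local Notation B := [tuple of Y ++ Z].
Hypothesis B_basis : basis_of fullv B.

Lemma pol_at_linear_form w (y : 'rV[K]_m) :
  pol_at (linear_form Y w) y = \sum_k coord Y k w * y 0 k.
Proof.
rewrite /pol_at raddf_sum; apply: eq_bigr => k _ /=.
by rewrite mevalZ mevalXU.
Qed.

Lemma invariant_polyP p : invariant_under mu Y n p -> invariant_poly mu Y p.
Proof.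
move=> ip; split; [exact: openT | by exists 0 | by move=> x _; exact: pol_at_differentiable |].
move=> x _ i; rewrite /coadjoint_field.
transitivity (- pol_at (coad mu Y Y`_i p) x); last first.
  by rewrite ip ?(basis_nth_mem Y_basis) // /pol_at meval0 oppr0.
rewrite coad_eval /dirderiv -sumrN; apply: eq_bigr => j _.
rewrite mxE pol_at_linear_form pol_at_partial -mulNr -sumrN mulr_suml.
by apply: eq_bigr => k _; rewrite !mulNr.
Qed.

Lemma adapted_lshift (i : 'I_m) : B`_(lshift 1 i) = Y`_i.
Proof. by rewrite nth_cat size_tuple /= ltn_ord. Qed.

Lemma adapted_rshift (i : 'I_1) : B`_(rshift m i) = Z`_0.
Proof. by rewrite nth_cat size_tuple /= ltnNge leq_addr /= addKn ord1. Qed.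

Lemma adapted_coord v : v \in n ->
  (forall k, coord B (lshift 1 k) v = coord Y k v) /\ (forall k, coord B (rshift m k) v = 0).
Proof.
move=> vn; have fB := basis_free B_basis.
split=> k; rewrite {1}(coord_basis Y_basis vn) linear_sum.
  rewrite (bigD1 k) //= big1 => [|i ik]; rewrite linearZ /= -adapted_lshift coord_free //.
    by rewrite eqxx mulr1 addr0.
  by rewrite (inj_eq (@lshift_inj _ _)) (negPf ik) mulr0.
rewrite big1 // => i _; rewrite linearZ /= -adapted_lshift coord_free //.
by rewrite eq_lrshift mulr0.
Qed.

(** Analogue of [coad_vector] on the dual of r. It only depends on the n-coordinates of [x], because
    all brackets lie in n. *)
Definition full_coad_row (v : V) (x : 'rV[K]_(m + 1)) : 'rV[K]_(m + 1) :=
  \row_j pol_at (linear_form Y (mu v B`_j)) (lsubmx x).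

Lemma full_coad_row_linear c u v x :
  full_coad_row (c *: u + v) x = c *: full_coad_row u x + full_coad_row v x.
Proof.
apply/rowP => j; rewrite !mxE brDl brZl linear_form_linear.
by rewrite /pol_at mevalD mevalZ.
Qed.

Lemma full_coad_rowE v x : full_coad_row v x =
  row_mx (coad_vector mu Y v (lsubmx x)) (const_mx (pol_at (linear_form Y (mu v Z`_0)) (lsubmx x))).
Proof.
rewrite -[LHS]hsubmxK; congr row_mx; apply/rowP => j; rewrite !mxE.
  by rewrite adapted_lshift.
by rewrite adapted_rshift.
Qed.

Lemma coadjoint_fieldE i F x :
  coadjoint_field mu B i F x = - \sum_j full_coad_row B`_i x 0 j * partial F j x.
Proof.
rewrite /coadjoint_field -sumrN; apply: eq_bigr => j _.
rewrite mxE pol_at_linear_form -mulNr -mulr_suml; congr (_ * _).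
have [cl cr] := adapted_coord (bracket_n B`_i B`_j).
rewrite big_split_ord /= [X in _ + X]big1 ?addr0 => [|k _]; last first.
  by rewrite /struct_const cr oppr0 mul0r.
by rewrite -sumrN; apply: eq_bigr => k _; rewrite /struct_const cl mulNr mxE.
Qed.

Lemma quotient_fun_coadjoint i P Q x : pol_at Q (lsubmx x) != 0 ->
  coadjoint_field mu B i (quotient_fun P Q) x =
  - (pol_at (coad mu Y B`_i P) (lsubmx x) * pol_at Q (lsubmx x) -
     pol_at P (lsubmx x) * pol_at (coad mu Y B`_i Q) (lsubmx x)) / pol_at Q (lsubmx x) ^+ 2.
Proof.
move=> Qx; rewrite coadjoint_fieldE mulNr; congr (- _).
under eq_bigr => j _ do rewrite /partial quotient_fun_derive // mulrA.
rewrite -mulr_suml; congr (_ / _); rewrite !coad_eval.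
under eq_bigr => j _ do rewrite mulrBr mulrA [X in _ - X]mulrCA.
rewrite sumrB -mulr_suml -mulr_sumr.
have dirE p : \sum_j full_coad_row B`_i x 0 j * dirderiv (lsubmx (delta_mx 0 j)) (lsubmx x) p
    = dirderiv (coad_vector mu Y B`_i (lsubmx x)) (lsubmx x) p.
  rewrite big_split_ord /= [X in _ + X]big1 ?addr0 => [|k _]; last first.
    rewrite /dirderiv big1 ?mulr0 // => l _.
    by rewrite !mxE eq_lrshift mul0r.
  apply: eq_bigr => k _; rewrite full_coad_rowE row_mxEl; congr (_ * _).
  rewrite /dirderiv (bigD1 k) //= big1 ?addr0 => [|l lk].
    by rewrite !mxE !eqxx mul1r.
  by rewrite !mxE (inj_eq (@lshift_inj _ _)) (negPf lk) mul0r.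
by rewrite !dirE.
Qed.

Lemma invariant_full_coad_row (W : set 'rV[K]_(m + 1)) F x v : invariant_on mu B W F -> W x ->
  \sum_j full_coad_row v x 0 j * partial F j x = 0.
Proof.
move=> [_ _ _ inv] Wx.
have basisE (i : 'I_(m + 1)) : \sum_j full_coad_row B`_i x 0 j * partial F j x = 0.
  by have /eqP := inv x Wx i; rewrite coadjoint_fieldE oppr_eq0 => /eqP.
pose L v := \sum_j full_coad_row v x 0 j * partial F j x.
have L_lin c u w : L (c *: u + w) = c * L u + L w.
  rewrite /L mulr_sumr -big_split; apply: eq_bigr => j _ /=.
  by rewrite full_coad_row_linear !mxE mulrDl mulrA.
have L0 : L 0 = 0.
  by have := L_lin (-1) 0 0; rewrite scaler0 addr0 mulN1r addNr.
rewrite -/(L v) (coord_basis B_basis (memvf v)).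
elim/big_rec: _ => [|i w _ Lw]; first exact: L0.
by rewrite L_lin Lw addr0 /L basisE mulr0.
Qed.

End Coordinates.

(** * Independence of quotients of powers *)

Section PowerQuotients.
Context {K : numClosedFieldType} {m d : nat}.

Lemma dirderiv_exp (w y : 'rV[K]_m) q e :
  dirderiv w y (q ^+ e) = pol_at q y ^+ e.-1 *+ e * dirderiv w y q.
Proof.
elim: e => [|e IHe].
  rewrite mulr0n mul0r expr0 -mpolyC1 /dirderiv big1 // => j _.
  by rewrite mderivC /pol_at meval0 mulr0.
have qX i : pol_at (q ^+ i) y = pol_at q y ^+ i by exact: rmorphXn.
rewrite exprS dirderivM IHe qX mulrS; case: e {IHe} => [|e] /=.
  by rewrite !mulr0n mul0r mulr0 expr0 !addr0 mulrC.
by rewrite mulrDl [dirderiv w y q * _]mulrC mulrA mulrnAr -exprS.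
Qed.

Lemma dirderiv_delta j (y : 'rV[K]_m) q :
  dirderiv (delta_mx 0 j) y q = pol_at (mderiv j q) y.
Proof.
rewrite /dirderiv (bigD1 j) //= big1 => [|i ij]; rewrite mxE ?eqxx ?mul1r ?addr0 //.
by rewrite (negPf ij) mul0r.
Qed.

Lemma lsubmx_delta (j : 'I_m) :
  lsubmx (delta_mx 0 (lshift d j)) = delta_mx 0 j :> 'rV[K]_m.
Proof. by apply/rowP => i; rewrite !mxE (inj_eq (@lshift_inj _ _)). Qed.

Lemma row_free_lsubmx k (J : 'M[K]_(k, m + d)) : row_free (lsubmx J) -> row_free J.
Proof.
move=> Jfree; apply: inj_row_free => v vJ; apply/eqP.
by rewrite -(mulmx_free_eq0 _ Jfree) mulmx_lsub vJ linear0.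
Qed.

Lemma power_quotients_independent k (p : 'I_k.+1 -> mpoly m K) (i0 : 'I_k.+1)
    (a b l : 'I_k -> nat) (x : 'rV[K]_(m + d)) :
  (forall i, (0 < a i)%N) -> row_free (jacobian_at p (lsubmx x)) ->
  (forall i, pol_at (p i) (lsubmx x) != 0) ->
  row_free (\matrix_(i, j) partial
    (quotient_fun (p (lift i0 i) ^+ a i * p i0 ^+ b i) (p i0 ^+ l i)) j x).
Proof.
move=> a0 Jfree p0; apply: row_free_lsubmx.
set y := lsubmx x in Jfree p0 *.
have pX q i : pol_at (q ^+ i) y = pol_at q y ^+ i by exact: rmorphXn.
pose u i := pol_at (p (lift i0 i)) y; pose v := pol_at (p i0) y.
have u0 i : u i != 0 by exact: p0.
have v0 : v != 0 by exact: p0.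
(* By the quotient rule each gradient combines those of [p (lift i0 i)] and [p i0], the former with
   a nonzero coefficient. *)
apply: (@quotient_jacobian_free _ _ _ _ i0 _
  (fun i => u i ^+ (a i).-1 *+ a i * v ^+ b i / v ^+ l i)
  (fun i => (u i ^+ a i * (v ^+ (b i).-1 *+ b i) * v ^+ l i
    - u i ^+ a i * v ^+ b i * (v ^+ (l i).-1 *+ l i)) / (v ^+ l i) ^+ 2)) Jfree _ _.
  move=> i; rewrite !mulf_neq0 ?invr_eq0 ?expf_neq0 //.
  by rewrite -mulr_natr mulf_neq0 ?expf_neq0 // pnatr_eq0 -lt0n.
move=> i; apply/rowP => j; rewrite !mxE /partial quotient_fun_derive -/y; last first.
  by rewrite pX expf_neq0.
rewrite lsubmx_delta !dirderivM !dirderiv_exp !dirderiv_delta pX.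
have -> : pol_at (p (lift i0 i) ^+ a i * p i0 ^+ b i) y = u i ^+ a i * v ^+ b i.
  by rewrite /pol_at mevalM -!/(pol_at _ _) !pX.
rewrite !pX -/(u i) -/v.
have : v ^+ l i != 0 by rewrite expf_neq0.
move: (pol_at (mderiv j _) y) (pol_at (mderiv j _) y) => e f.
move: (u i ^+ (a i).-1 *+ a i) (v ^+ (b i).-1 *+ b i) (v ^+ (l i).-1 *+ l i).
move: (u i ^+ a i) (v ^+ b i) (v ^+ l i).
by move=> s t q g1 g2 g3 q0; field.
Qed.

End PowerQuotients.

(** * Dependence of any k + 1 invariants of r *)

Section MaximalFamily.
Context {K : numClosedFieldType} {V : vectType K} (mu : bilin V).
Hypothesis mu_lie : lie_law mu.
Context (n : {vspace V}) (m : nat) (Y : m.-tuple V) (Z : 1.-tuple V).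
Hypothesis Y_basis : basis_of n Y.
Hypothesis bracket_n : forall u v, mu u v \in n.
Local Notation B := [tuple of Y ++ Z].
Hypothesis B_basis : basis_of fullv B.
Context (z : V) (e : K).
Hypotheses (z_central : forall u, u \in n -> mu u z = 0) (z_eigen : mu Z`_0 z = e *: z).
Context (k : nat) (p : 'I_k.+1 -> mpoly m K) (i0 : 'I_k.+1) (y : 'rV[K]_m).
Hypothesis Jfree : row_free (jacobian_at p y).
Hypothesis tangent : forall w, (forall i, dirderiv w y (p i) = 0) ->
  exists2 u, u \in n & w = coad_vector mu Y u y.
Hypothesis moved : pol_at (coad mu Y Z`_0 (p i0)) y != 0.
Hypotheses (e0 : e != 0) (zy : pol_at (linear_form Y z) y != 0).

Lemma invariants_dependent (x : 'rV[K]_(m + 1)) (H : 'I_k.+1 -> 'rV[K]_(m + 1) -> K) :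
  lsubmx x = y -> (forall l, exists2 W, W x & invariant_on mu B W (H l)) ->
  ~~ row_free (\matrix_(l, j) partial (H l) j x).
Proof.
move=> xy Hinv; set J := \matrix_(_, _) _.
have annih v l : \sum_j full_coad_row mu Y Z v x 0 j * partial (H l) j x = 0.
  have [W Wx WH] := Hinv l.
  exact: (invariant_full_coad_row Y_basis bracket_n B_basis v WH Wx).
(* The coadjoint vector of [z] points along the T-coordinate only, and is nonzero at [x]. *)
have last0 l : partial (H l) (rshift m ord0) x = 0.
  have := annih z l; rewrite big_split_ord /= big1 => [|j _]; last first.
    rewrite full_coad_rowE row_mxEl mxE (lie_anti mu_lie) z_central ?(basis_nth_mem Y_basis) //.
    by rewrite oppr0 linear_form0 /pol_at meval0 mul0r.
  rewrite add0r big_ord1 full_coad_rowE row_mxEr mxE (lie_anti mu_lie) z_eigen xy.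
  rewrite -scaleNr linear_formZ /pol_at mevalZ => /eqP; rewrite !mulf_eq0 oppr_eq0.
  by rewrite (negPf e0) -/(pol_at _ _) (negPf zy) => /eqP.
have annihA v : coad_vector mu Y v y *m (lsubmx J)^T = 0.
  apply/rowP => l; rewrite !mxE -[RHS](annih v l) big_split_ord /= big_ord1 last0 mulr0 addr0.
  by apply: eq_bigr => j _; rewrite full_coad_rowE row_mxEl xy !mxE.
have JE : J = row_mx (lsubmx J) 0.
  rewrite -[LHS]hsubmxK; congr row_mx; apply/matrixP => l j; rewrite !mxE.
  by rewrite [j]ord1 last0.
apply: contra (_ : ~~ row_free (lsubmx J)) => [Jf|].
  apply: inj_row_free => v vJ; apply/eqP; rewrite -(mulmx_free_eq0 _ Jf) JE.
  by rewrite mul_mx_row vJ mulmx0 row_mx0.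
(* The differentials kill the tangent space of the n-orbit, which contains the common kernel of the
   [p i], and also the vector of T, which moves [p i0]. *)
apply: (transverse_rank (G := jacobian_at p y) (t := coad_vector mu Y Z`_0 y)) => //.
  move=> w wJ; have [|u _ ->] := tangent (w := w); last exact: annihA.
  by move=> i; rewrite dirderiv_jacobian_at wJ mxE.
by apply: contraNneq moved => tJ; rewrite coad_eval dirderiv_jacobian_at tJ mxE.
Qed.

End MaximalFamily.

(** * Construction of the fundamental set *)

Lemma rank_one_fundamental_set {K : numClosedFieldType} {V : vectType K} (mu : bilin V)
    (n : {vspace V}) (m : nat) (Y : m.-tuple V) (Z : 1.-tuple V) :
  lie_law mu -> rigid mu -> trivial_center mu ->
  nilpotent_in mu n -> is_ideal mu n -> semisimple_end (mu Z`_0) ->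
  (n + <[Z`_0]>)%VS = fullv -> Z`_0 \notin n -> basis_of n Y ->
  exists (k : nat) (P Q : 'I_k -> mpoly m K),
    [/\ forall i, invariant_poly mu Y (P i),
        forall i, invariant_poly mu Y (Q i),
        forall i, Q i != 0 &
        fundamental_set mu [tuple of Y ++ Z]
          [set x : 'rV[K]_(m + 1) | forall i, pol_at (Q i) (lsubmx x) != 0]
          (fun i x => pol_at (P i) (lsubmx x) / pol_at (Q i) (lsubmx x))].
Proof.
move=> mu_lie mu_rigid mu_center n_nil n_ideal Tss nT Tn Y_basis.
set T := Z`_0 in Tss nT Tn.
have decompV v : exists c, v - c *: T \in n.
  have : v \in (n + <[T]>)%VS by rewrite nT memvf.
  by case/memv_addP => u un [_ /vlineP [c ->] ->]; exists c; rewrite addrK.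
have bracket_n := codim1_ideal_bracket mu_lie n_ideal decompV.
have T0 : T != 0 by apply: contraNneq Tn => ->; rewrite mem0v.
have ZE : Z = [tuple T] by apply: val_inj; rewrite /= /T; case: Z {T Tss nT Tn decompV T0} => [[|t []]].
have central v : (forall u, u \in n -> mu v u = 0) -> mu v T = 0 -> v = 0.
  move=> vn vT; apply: mu_center => u; have [c uc] := decompV u.
  have -> : mu v u = mu v (u - c *: T) + c *: mu v T.
    by rewrite -linearZ -linearD subrK.
  by rewrite vn // vT scaler0 addr0.
have n0 : n != 0%VS.
  apply: contraNneq T0 => n0; rewrite (central T) // => [u|]; last by have [] := mu_lie.
  by rewrite n0 memv0 => /eqP ->; rewrite linear0.
have [z [e [zn z0 Tz zc]]] := central_eigenvector mu_lie n_nil n_ideal T n0.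
have e0 : e != 0.
  apply: contraNneq z0 => e0; apply/eqP/central => [u un|].
    by rewrite (lie_anti mu_lie) zc // oppr0.
  by rewrite (lie_anti mu_lie) Tz e0 scale0r oppr0.
have [c [X [c0 X_basis X_weight]]] :=
  rational_torus_weights mu_lie mu_rigid n_nil n_ideal Tss nT Tn.
have [s [p [r [h [h0 ip wp hP]]]]] :=
  weight_invariant_family mu_lie n_nil n_ideal Y_basis c0 X_basis X_weight.
set lz := linear_form Y z.
have lz0 : lz != 0.
  apply: contraNneq z0 => lz0; rewrite (coord_basis Y_basis zn) big1 // => i _.
  have := pol_at_linear_form Y z (delta_mx 0 i); rewrite -/lz lz0 /pol_at meval0.
  rewrite (bigD1 i) //= big1 => [|j ji]; last by rewrite mxE (negPf ji) andbF mulr0.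
  by rewrite mxE !eqxx mulr1 addr0 => <-; rewrite scale0r.
have ilz : invariant_under mu Y n lz.
  by move=> u un; rewrite (coad_linear_form _ Y_basis _ zn) zc // linear_form0.
have [y0] : exists y, pol_at (h * lz) y != 0 by apply: pol_at_neq0; rewrite mulf_neq0.
rewrite /pol_at mevalM mulf_eq0 negb_or => /andP [hy0 lzy0].
have [Jy0 _ /(_ lz ilz) /submxP [D lzD]] := hP y0 hy0.
(* If all weights were zero, the vector of T at [y0] would kill the gradients of the [p i], hence
   that of [lz]; but T scales [lz] by [e], and [lz] is nonzero at [y0]. *)
have [i0 ri0] : exists i, r i != 0.
  apply: contrapT => nr; move/negP: lzy0; apply.
  have : e * pol_at lz y0 = 0.
    have <- : pol_at (coad mu Y T lz) y0 = e * pol_at lz y0.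
      by rewrite (coad_linear_form _ Y_basis _ zn) Tz linear_formZ /pol_at mevalZ.
    rewrite coad_eval dirderivE lzD trmx_mul mulmxA.
    suff -> : coad_vector mu Y T y0 *m (jacobian_at p y0)^T = 0 by rewrite mul0mx mxE.
    apply/rowP => i; rewrite -dirderiv_jacobian_at -coad_eval (wp i) mxE.
    suff -> : r i = 0 by rewrite rmorph0 mulr0 scale0r /pol_at meval0.
    by apply/eqP/negPn/negP => ri; apply: nr; exists i.
  by move/eqP; rewrite mulf_eq0 (negPf e0).
case: s p r i0 ri0 ip wp hP Jy0 D lzD => [|k] p r i0; first by case: i0.
move=> ri0 ip wp hP Jy0 _ _.
have p0 i : p i != 0.
  apply/eqP => pi0; have : row i (jacobian_at p y0) = 0.
    by apply/rowP => j; rewrite !mxE pi0 linear0 /pol_at meval0.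
  rewrite rowE => /eqP; rewrite (mulmx_free_eq0 _ Jy0) => /eqP /rowP /(_ i) /eqP.
  by rewrite !mxE !eqxx oner_eq0.
(* Nonvanishing of [g] collects all generic conditions. *)
pose g := h * lz * \prod_i p i.
have g0 : g != 0 by rewrite !mulf_neq0 //; apply/prodf_neq0.
have gP y : pol_at g y != 0 ->
    [/\ pol_at h y != 0, pol_at lz y != 0 & forall i, pol_at (p i) y != 0].
  rewrite /pol_at !mevalM rmorph_prod !mulf_eq0 !negb_or => /andP [/andP [hy lzy]].
  by move=> /prodf_neq0 py; split=> // i; exact: py.
have expo (i : 'I_k) := rat_exponents (r (lift i0 i)) ri0.
have [a {}expo] := choice expo.
have [b {}expo] := choice expo.
have [l {}expo] := choice expo.
(* The exponents give [P i] and [Q i] equal weight, so T kills their quotient. *)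
pose P i := p (lift i0 i) ^+ a i * p i0 ^+ b i.
pose Q i := p i0 ^+ l i.
have iP i : invariant_under mu Y n (P i) by apply: invariant_underM; exact: invariant_underX.
have iQ i : invariant_under mu Y n (Q i) by exact: invariant_underX.
have Q0 i : Q i != 0 by rewrite expf_neq0.
have wP i : has_weight mu Y T c (r i0 *+ l i) (P i).
  have [_ <-] := expo i; apply: has_weightM; exact: has_weightX.
have wQ i : has_weight mu Y T c (r i0 *+ l i) (Q i) by exact: has_weightX.
have B_basis : basis_of fullv [tuple of Y ++ Z].
  rewrite -nT; apply: cat_basis => //; last first.
    by rewrite ZE /= seq1_basis.
  apply/directv_addP/eqP; rewrite -subv0; apply/subvP => v.
  rewrite memv_cap => /andP [vn /vlineP [q vq]].
  have [q0|q0] := eqVneq q 0; first by rewrite vq q0 scale0r mem0v.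
  by case/negP: Tn; rewrite -[T](scalerK q0) -vq memvZ.
exists k, P, Q.
set U := [set x | _].
have UE : U = [set x | pol_at (\prod_i Q i) (lsubmx x) != 0].
  apply/seteqP; split=> x /=; rewrite /pol_at rmorph_prod /=.
    by move=> Ux; apply/prodf_neq0 => i _; exact: Ux.
  by move=> /prodf_neq0 Ux i; exact: Ux.
have Uo : open U by rewrite UE; exact: pol_at_lsubmx_open.
have gU x : pol_at g (lsubmx x) != 0 -> U x.
  move=> /gP [_ _ px] i.
  rewrite -[meval _ _]/(pol_at (Q i) (lsubmx x)) [pol_at _ _]rmorphXn.
  exact/expf_neq0/px.
have Fdiff i x : U x -> differentiable (quotient_fun (P i) (Q i)) x.
  by move=> Ux; apply: quotient_fun_differentiable; exact: Ux.
have U0 : U !=set0.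
  have [x _ /gU Ux] := pol_at_lsubmx_dense g0 openT (ex_intro _ (0 : 'rV[K]_(m + 1)) I).
  by exists x.
have Finv i : invariant_on mu [tuple of Y ++ Z] U (quotient_fun (P i) (Q i)).
  split=> // [x Ux|x Ux j]; first exact: Fdiff.
  rewrite (quotient_fun_coadjoint Y_basis bracket_n B_basis _ _ (Ux i)).
  have [[q ->]|[q ->]] : (exists q, j = lshift 1 q) \/ (exists q, j = rshift m q).
    by case: (split_ordP j) => q ->; [left | right]; exists q.
    rewrite adapted_lshift iP ?iQ ?(basis_nth_mem Y_basis) //.
    by rewrite /pol_at !meval0 mul0r mulr0 subrr oppr0 mul0r.
  rewrite adapted_rshift (wP i) (wQ i) /pol_at !mevalZ mulrA [X in _ - X]mulrA.
  by rewrite [X in _ - X * _]mulrC subrr oppr0 mul0r.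
split=> //.
- by move=> i; exact: (invariant_polyP Y_basis (iP i)).
- by move=> i; exact: (invariant_polyP Y_basis (iQ i)).
split=> //.
(* Independence: points where [g] is nonzero are dense in [U]. *)
- move=> x Ux A /nbhs_interior xA.
  have [|x1 [Ux1 Ax1] gx1] := pol_at_lsubmx_dense g0 (openI Uo (open_interior A)).
    by exists x; split=> //; exact: nbhs_singleton.
  exists x1; split; last exact: interior_subset.
  split=> //; have [hx _ px] := gP _ gx1; have [Jx _ _] := hP _ hx.
  by apply: power_quotients_independent => // i; have [] := expo i.
(* Maximality: some point of [W] where [g] is nonzero would have [k + 1] independent differentials
   of invariants. *)
- move=> W G WU Ginv indep; have [Wo W0 _ _] := Ginv.
  have [x1 Wx1 gx1] := pol_at_lsubmx_dense g0 Wo W0.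
  have Wg : nbhs x1 (W `&` [set x | pol_at g (lsubmx x) != 0]).
    apply: open_nbhs_nbhs; split; last by split.
    by apply: openI => //; exact: pol_at_lsubmx_open.
  have [x [[Wx Jx] [_ gx]]] := indep _ Wx1 _ Wg.
  have [hx lzx px] := gP _ gx; have [Jpx tanx _] := hP _ hx.
  have moved : pol_at (coad mu Y T (p i0)) (lsubmx x) != 0.
    by rewrite (wp i0) /pol_at mevalZ mulf_neq0 ?px // mulf_neq0 // fmorph_eq0.
  move: Jx; apply/negP.
  apply: (invariants_dependent mu_lie Y_basis bracket_n B_basis zc Tz Jpx tanx moved e0 lzx erefl).
  move=> q; rewrite /extend_family; case: unliftP => [i _|_].
    by exists U; [exact: WU | exact: Finv].
  by exists W.
Qed.

Local Open Scope complex_scope.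

Theorem proposition5 (R : realType) (V : vectType R[i]) (mu : bilin V)
    (n t : {vspace V}) (m d : nat) (Y : m.-tuple V) (Z : d.-tuple V)
    (mu_lie : lie_law mu)
    (mu_solvable : solvable_law mu)
    (mu_rigid : rigid mu)
    (mu_center : trivial_center mu)
    (n_nilradical : is_nilradical mu n)
    (t_torus : is_torus mu t)
    (nt_full : (n + t)%VS = fullv)
    (nt_direct : (n :&: t)%VS = 0%VS)
    (rank_one : \dim t = 1%N)
    (Y_basis : basis_of n Y)
    (Z_basis : basis_of t Z) :
  exists (k : nat) (P Q : 'I_k -> mpoly m R[i]),
    [/\ forall i, invariant_poly mu Y (P i),
        forall i, invariant_poly mu Y (Q i),
        forall i, Q i != 0 &
        fundamental_set mu [tuple of Y ++ Z]
          [set x : 'rV[R[i]]_(m + d) | forall i, pol_at (Q i) (lsubmx x) != 0]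
          (fun i x => pol_at (P i) (lsubmx x) / pol_at (Q i) (lsubmx x))].
Proof.
have d1 : d = 1%N by rewrite -rank_one -(span_basis Z_basis) (eqP (basis_free Z_basis)) size_tuple.
subst d; have [n_ideal n_nil _] := n_nilradical; have [_ t_ss] := t_torus.
have Zt : Z`_0 \in t by rewrite -(span_basis Z_basis) memv_span // mem_nth ?size_tuple.
have Z0 : Z`_0 != 0.
  by apply: (free_not0 (basis_free Z_basis)); rewrite mem_nth ?size_tuple.
have tE : t = <[Z`_0]>%VS.
  have sub : (<[Z`_0]> <= t)%VS by rewrite -memvE.
  by apply/eqP; rewrite eq_sym -(dimv_leqif_eq sub) rank_one dim_vline Z0.
have Zn : Z`_0 \notin n.
  by apply: contra Z0 => Zn; rewrite -memv0 -nt_direct memv_cap Zn.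
rewrite tE in nt_full.
exact: (rank_one_fundamental_set mu_lie mu_rigid mu_center n_nil n_ideal
  (t_ss _ Zt) nt_full Zn Y_basis).
Qed.
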